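(* For $x\ge 0$ and $n\ge 0$ let $P_n(x)=P(H(x)\le n)$, where $H(x)$ is the height of the tree generated by the continuum cascade model on $[0,x]$. For $n\ge 1$ let $H_n$ be the position of the left-most particle of generation $n$ in the branching Poisson point process started from one particle at $0$, whose reproduction point process is a Poisson point process of intensity $1$ on $[0,\infty)$. Then for all $n\ge 1$ and $x\ge 0$, $$P_{n-1}(x)=P(H(x)\le n-1)=P(H_n\ge x).$$
   Context: Continuum cascade model on $[0,x]$, $x\ge 0$: the root is located at $0$. At step $1$, the points of a Poisson point process of unit intensity on $[0,x]$ are generated (that is, a Poisson($x$) number of points, placed independently and uniformly), and each is joined by an edge to the root. At each step $u>1$, each point generated at step $u-1$, located at $y\in[0,x]$, independently generates the points of a Poisson point process of unit intensity on $[y,x]$ (a Poisson($x-y$) number of independent uniform points on $[y,x]$), independently of all other points and previous steps, and is joined by an edge to each of them. This continues as long as new points are generated. The height $H(x)$ is the length (number of edges) of the longest path from the root in the resulting tree, so $H(x)=0$ if no point is generated at step $1$. The functions $P_n$ satisfy $P_0(x)=e^{-x}$ and $P_n(x)=\exp[-x+\int_0^xP_{n-1}(y)\,dy]$ for $n\ge 1$. Branching Poisson point process: it starts with one particle at $0$ (generation $0$); at each time $n$, each particle of generation $n$ dies and gives birth to an independent copy of a Poisson point process of intensity $1$ on $[0,\infty)$, translated by its position. $H_n$ is the minimum of the positions of the particles of generation $n$ (no particles are killed). *)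

(* Defs.v *)
From mathcomp Require Import all_boot all_order all_algebra.
From mathcomp Require Import all_classical all_reals all_analysis.

Set Implicit Arguments.
Unset Strict Implicit.
Unset Printing Implicit Defensive.

Import Order.TTheory GRing.Theory Num.Theory.
Import numFieldNormedType.Exports.

Local Open Scope classical_set_scope.
Local Open Scope ring_scope.

(* Individuals carry Ulam-Harris labels: [::] is the root, and rcons v i is
   the i-th child (i = 0, 1, ...) of the individual v. *)
Notation label := (seq nat).

(* Probability of the value k under the Poisson(r) law. The library's
   poisson_pmf is constantly 1 at rate 0, whereas poisson_prob is the Dirac mass
   at 0 there, as it should be; its second argument is not used. *)
Definition poisson_weight (R : realType) (r : R) (k : nat) : \bar R :=
  poisson_prob r 0%N [set k].

(* The uniform law on [a, b]: the body of the library's uniform_prob, without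
   its argument of type a < b. *)
Definition uniform_law (R : realType) (a b : R) (B : set R) : \bar R :=
  (\int[lebesgue_measure]_(z in B) (uniform_pdf a b z)%:E)%E.

(** Continuum cascade model.
    N v is the number of points generated by the point v, and X v is the
    location of v; their values matter only when v belongs to the tree. *)

Section cascade_tree.
Context {T : Type} (N : label -> T -> nat).

Definition children (w : T) (v : label) : seq label :=
  [seq rcons v i | i <- iota 0 (N v w)].

(* the points generated at step u (step 0: the root) *)
Fixpoint step (u : nat) (w : T) : seq label :=
  if u is u'.+1 then flatten [seq children w v | v <- step u' w]
  else [:: [::]].

Definition edge (w : T) : rel label := fun v v' => v' \in children w v.

(* Number of edges of the longest path from the root, +oo if unbounded. *)
Definition height (R : realType) (w : T) : \bar R :=
  ereal_sup [set ((size p)%:R)%:E | p in [set p | path (edge w) [::] p]].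

End cascade_tree.
Arguments height {T} N R w.

(* sigma-algebra generated by the tree and the locations up to step u *)
Definition history {T : Type} {R : realType} (N : label -> T -> nat)
    (X : label -> T -> R) (u : nat) : set (set T) :=
  <<s [set E | exists v B, [/\ (size v <= u)%N, measurable B &
         E = [set w | v \in step N (size v) w /\ B (X v w)] ] ] >>.

(* Given the history up to step u, the points v of step u independently
   generate Poisson(x - X v) many points, independent and uniform on [X v, x]. *)
Record continuum_cascade (R : realType) (d : measure_display)
    (T : measurableType d) (P : probability T R) (x : R)
    (N : label -> {RV P >-> nat}) (X : label -> {RV P >-> R}) : Prop := {
  cascade_root : forall w, X [::] w = 0;
  cascade_law : forall (u : nat) (A : set T) (S : seq label)
      (k : label -> nat) (B : label -> nat -> set R),
    history N X u A -> (forall v i, measurable (B v i)) ->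
    P (A `&` [set w | step N u w = S] `&`
       [set w | forall v, v \in S ->
          N v w = k v /\ forall i, (i < k v)%N -> B v i (X (rcons v i) w)]) =
    (\int[P]_(w in A `&` [set w | step N u w = S])
       \big[*%E/1]_(v <- S)
         (poisson_weight (x - X v w) (k v) *
          \big[*%E/1]_(i < k v) uniform_law (X v w) x (B v i)))%E }.

Arguments continuum_cascade {R d T} P x N X.

(* P_n(x), for a realization of the cascade model on [0, x] *)
Definition height_cdf (R : realType) (d : measure_display)
    (T : measurableType d) (P : probability T R)
    (N : label -> {RV P >-> nat}) (n : nat) : \bar R :=
  P [set w | (height N R w <= (n%:R)%:E)%E].
Arguments height_cdf {R d T} P N n.

(** Branching Poisson point process.
    xi v i is the displacement of the i-th child of v from v. *)

(* number of points of the sequence xi in B *)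
Definition count_points {T : Type} {R : realType} (xi : nat -> T -> R)
    (w : T) (B : set R) : \bar R :=
  (\sum_(0 <= i <oo) \d_(xi i w) B)%E.

(* The points (xi i)_i form a Poisson point process of unit intensity on D. *)
Definition poisson_process (R : realType) (d : measure_display)
    (T : measurableType d) (P : probability T R) (D : set R)
    (xi : nat -> {RV P >-> R}) : Prop :=
  forall (m : nat) (B : 'I_m -> set R) (k : 'I_m -> nat),
    (forall j, measurable (B j)) -> trivIset setT B ->
    (forall j, lebesgue_measure (B j `&` D) < +oo)%E ->
    (P [set w | forall j, count_points xi w (B j) = ((k j)%:R)%:E] =
     \big[*%E/1]_(j < m)
       poisson_weight (fine (lebesgue_measure (B j `&` D))) (k j))%E.

Arguments poisson_process {R d T} P D xi.

Definition sigma_of_sequence {T : Type} {R : realType} (xi : nat -> T -> R) :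
    set (set T) :=
  <<s [set E | exists i B, measurable B /\ E = xi i @^-1` B] >>.

Definition mutually_independent (R : realType) (d : measure_display)
    (T : measurableType d) (P : probability T R) (I : eqType)
    (F : I -> set (set T)) : Prop :=
  forall (s : seq I) (E : I -> set T), uniq s ->
    (forall v, v \in s -> F v (E v)) ->
    P [set w | forall v, v \in s -> E v w] = (\big[*%E/1]_(v <- s) P (E v))%E.

(* A Poisson point process on [0, +oo[ of unit intensity has almost surely
   infinitely many points, so every individual has a child for each i : nat. *)
Record branching_poisson (R : realType) (d : measure_display)
    (T : measurableType d) (P : probability T R)
    (xi : label -> nat -> {RV P >-> R}) : Prop := {
  branching_reproduction : forall v, poisson_process P `[0, +oo[ (xi v);
  branching_independence :
    mutually_independent P (fun v => sigma_of_sequence (xi v)) }.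

Arguments branching_poisson {R d T} P xi.

Definition position {T : Type} {R : realType} (xi : label -> nat -> T -> R)
    (v : label) (w : T) : R :=
  \sum_(i < size v) xi (take i v) (nth 0%N v i) w.

(* H_n *)
Definition leftmost {T : Type} {R : realType} (xi : label -> nat -> T -> R)
    (n : nat) (w : T) : \bar R :=
  ereal_inf [set (position xi v w)%:E | v in [set v | size v = n]].

(* Main.v *)
Require Import Defs.
From HB Require Import structures.
From mathcomp Require Import all_boot all_order all_algebra.
From mathcomp Require Import all_classical all_reals all_analysis measurable_realfun.
From mathcomp Require Import ring lra.

Set Implicit Arguments.
Unset Strict Implicit.
Unset Printing Implicit Defensive.

Import Order.TTheory GRing.Theory Num.Theory.
Import numFieldNormedType.Exports.

Local Open Scope classical_set_scope.
Local Open Scope ring_scope.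

(**
  Fix x and let (L g)(y) := exp(- int_y^x (1 - g)), the Laplace functional of
  the Poisson process of unit intensity on [y, x]. Both probabilities are equal
  to (L^n 0)(0).

  Cascade: integrating out the last step, given the history, turns the
  expectation of the product of g over the points of step u + 1 into the
  expectation of the product of L g over the points of step u. Iterating down to
  the root from g = 0 computes the probability that step n is empty.

  Branching process: decompose at the first generation. The subtrees of the
  children are independent, and independent of the positions of the children, so
  the probability that all individuals of generation m + 1 above an individual
  at y lie beyond x is the expectation of the product, over the children z of y,
  of the corresponding probability for generation m and z. This is again L
  applied to the latter.
*)

(** * Limits of real sequences, multilinear extension of integral identities *)

(** Both models are specified only on elementary events: fixed numbers of children and Borel boxes
    for the cascade, prescribed counts in disjoint sets for the Poisson process. The passage to
    products of a general g avoids conditional expectations: pairs of a function and its averaged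
    counterpart are closed under sums and increasing limits, one factor at a time. In the branching
    process every individual has infinitely many children, so the products are infinite; the cutoff
    at x tames them, all functions involved being 1 beyond x. The recursion there starts from the
    indicator of [x, +oo[ and not from 0. On [y, x] these differ only at the point x, so one
    application of L erases the difference. The indices match because height at most n - 1 means
    that step n is empty, which costs n applications of L, as generation n does. *)

Section RealLimits.
Context {R : realType}.
Implicit Types (u v : nat -> R).

Lemma cvgn_ge0 u l : (forall n, 0 <= u n) -> u @ \oo --> l -> 0 <= l.
Proof.
move=> u0 ul; rewrite -(cvg_lim _ ul)//.
by apply: limr_ge; [apply/cvg_ex; exists l|exact: nearW].
Qed.

Lemma ler_cvgn u v l m : (forall n, u n <= v n) ->
  u @ \oo --> l -> v @ \oo --> m -> l <= m.
Proof.
move=> uv ul vm; rewrite -subr_ge0.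
apply: (@cvgn_ge0 (fun n => v n - u n)); last exact: cvgB.
by move=> n; rewrite subr_ge0.
Qed.

Lemma cvgn_prod (I : eqType) (s : seq I) (u : nat -> I -> R) (l : I -> R) :
  (forall i, i \in s -> u^~ i @ \oo --> l i) ->
  \prod_(i <- s) u n i @[n --> \oo] --> \prod_(i <- s) l i.
Proof.
elim: s => [|i s IH] ul.
  rewrite big_nil; under eq_fun do rewrite big_nil; exact: cvg_cst.
rewrite big_cons; under eq_fun do rewrite big_cons.
apply: cvgM; first by apply: ul; rewrite mem_head.
by apply: IH => j js; apply: ul; rewrite inE js orbT.
Qed.

End RealLimits.

Section RealIntegrals.
Context d (T : measurableType d) (R : realType).

Lemma measurable_fun_cvgn (f_ : nat -> T -> R) (f : T -> R) :
  (forall n, measurable_fun setT (f_ n)) ->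
  (forall w, f_^~ w @ \oo --> f w) -> measurable_fun setT f.
Proof.
move=> mf fc; apply/measurable_EFinP.
apply: (emeasurable_fun_cvg (fun n => EFin \o f_ n)).
  by move=> n; exact/measurable_EFinP.
by move=> w _; apply/fine_cvgP; split; [exact: nearW|exact: fc].
Qed.

Lemma cvg_integral_EFin (mu : {measure set T -> \bar R}) (D : set T)
    (f_ : nat -> T -> R) (f : T -> R) : measurable D ->
  (forall n, measurable_fun setT (f_ n)) -> (forall n w, 0 <= f_ n w) ->
  (forall w, {homo f_^~ w : m n / (m <= n)%N >-> m <= n}) ->
  (forall w, f_^~ w @ \oo --> f w) ->
  (\int[mu]_(w in D) (f_ n w)%:E)%E @[n --> \oo]
    --> (\int[mu]_(w in D) (f w)%:E)%E.
Proof.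
move=> mD mf f0 nd fc.
have -> : (\int[mu]_(w in D) (f w)%:E)%E =
    (\int[mu]_(w in D) (fun w => limn (fun n => (f_ n w)%:E)) w)%E.
  apply: eq_integral => w _; apply/esym/cvg_lim => //.
  by apply/fine_cvgP; split; [exact: nearW|exact: fc].
apply: cvg_monotone_convergence => //.
- by move=> n; apply/measurable_EFinP; exact: measurable_funTS.
- by move=> n w _; rewrite lee_fin.
- by move=> w _ m n mn; rewrite lee_fin nd.
Qed.

End RealIntegrals.

Section Closure.
Context d (T : measurableType d) (R : realType).
Implicit Types (B : (T -> R) -> (T -> R) -> Prop) (a b : T -> R).

(* Multilinear monotone-class argument: an identity between the expectations of
   two products, stated for basic factors only, extends to all factors obtained
   from basic ones by linear combinations and monotone limits, taken on both
   sides simultaneously (closure_pair_prod). *)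
Inductive closure_pair B : (T -> R) -> (T -> R) -> Prop :=
| cl_basic a b : B a b -> closure_pair B a b
| cl_zero : closure_pair B (fun=> 0) (fun=> 0)
| cl_add a b a' b' : closure_pair B a b -> closure_pair B a' b' ->
    closure_pair B (fun w => a w + a' w) (fun w => b w + b' w)
| cl_scale c a b : 0 <= c -> closure_pair B a b ->
    closure_pair B (fun w => c * a w) (fun w => c * b w)
| cl_lim (a_ b_ : nat -> T -> R) a b :
    (forall n, closure_pair B (a_ n) (b_ n)) ->
    (forall w, {homo a_^~ w : m n / (m <= n)%N >-> m <= n}) ->
    (forall w, {homo b_^~ w : m n / (m <= n)%N >-> m <= n}) ->
    (forall w, a_^~ w @ \oo --> a w) ->
    (forall w, b_^~ w @ \oo --> b w) ->
    closure_pair B a b.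

Lemma closure_pair_ext B a b a' b' :
  closure_pair B a b -> a =1 a' -> b =1 b' -> closure_pair B a' b'.
Proof. by move=> ab /funext <- /funext <-. Qed.

Lemma closure_pair_sum B (a b : nat -> T -> R) n :
  (forall k, closure_pair B (a k) (b k)) ->
  closure_pair B (fun w => \sum_(k < n) a k w) (fun w => \sum_(k < n) b k w).
Proof.
move=> ab; elim: n => [|n IH].
  by apply: (closure_pair_ext (cl_zero B)) => w; rewrite big_ord0.
by apply: (closure_pair_ext (cl_add IH (ab n))) => w; rewrite big_ord_recr.
Qed.

Definition good_pair a b :=
  [/\ measurable_fun setT a, measurable_fun setT b,
      forall w, 0 <= a w & forall w, 0 <= b w].

Lemma closure_pair_good B a b :
  (forall a b, B a b -> good_pair a b) -> closure_pair B a b -> good_pair a b.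
Proof.
move=> B0; elim => {a b}.
- by move=> a b /B0.
- by [].
- move=> a b a' b' _ [? ? ? ?] _ [? ? ? ?]; split.
  + exact: measurable_funD.
  + exact: measurable_funD.
  + by move=> w; exact: addr_ge0.
  + by move=> w; exact: addr_ge0.
- move=> c a b c0 _ [? ? ? ?]; split.
  + exact: measurable_funM.
  + exact: measurable_funM.
  + by move=> w; exact: mulr_ge0.
  + by move=> w; exact: mulr_ge0.
- move=> a_ b_ a b _ h nda ndb ca cb; split.
  + by apply: measurable_fun_cvgn ca => n; have [] := h n.
  + by apply: measurable_fun_cvgn cb => n; have [] := h n.
  + by move=> w; apply: (cvgn_ge0 _ (ca w)) => n; have [] := h n.
  + by move=> w; apply: (cvgn_ge0 _ (cb w)) => n; have [] := h n.
Qed.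

(** Only one factor varies, f and g carrying all the others: by nonnegativity both integrals are
    additive in it and pass to increasing limits. *)
Lemma closure_pair_integral (mu : {measure set T -> \bar R}) (D : set T)
    B (f g a b : T -> R) : measurable D ->
  (forall a b, B a b -> good_pair a b) -> good_pair f g ->
  (forall a b, B a b -> (\int[mu]_(w in D) (f w * a w)%:E =
                         \int[mu]_(w in D) (g w * b w)%:E)%E) ->
  closure_pair B a b ->
  (\int[mu]_(w in D) (f w * a w)%:E = \int[mu]_(w in D) (g w * b w)%:E)%E.
Proof.
move=> mD B0 [mf mg f0 g0] HB.
have mEF h : measurable_fun setT h -> measurable_fun D (EFin \o h).
  by move=> mh; apply/measurable_EFinP; exact: measurable_funTS.
elim => {a b}.
- exact: HB.
- by under eq_integral do rewrite mulr0; under [RHS]eq_integral do rewrite mulr0.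
- move=> a b a2 b2 cab E cab2 E2.
  have [ma mb a0 b0] := closure_pair_good B0 cab.
  have [ma2 mb2 a20 b20] := closure_pair_good B0 cab2.
  under eq_integral do rewrite mulrDr EFinD.
  under [RHS]eq_integral do rewrite mulrDr EFinD.
  rewrite !ge0_integralD//; last first.
  all: try by [move=> w _; rewrite lee_fin mulr_ge0|apply: mEF; exact: measurable_funM].
  by rewrite E E2.
- move=> c a b c0 cab E.
  have [ma mb a0 b0] := closure_pair_good B0 cab.
  under eq_integral do rewrite mulrCA EFinM.
  under [RHS]eq_integral do rewrite mulrCA EFinM.
  rewrite !ge0_integralZl_EFin// ?E//.
  all: try by [move=> w _; rewrite lee_fin mulr_ge0|apply: mEF; exact: measurable_funM].
- move=> a_ b_ a b cab E nda ndb ca cb.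
  have gd n := closure_pair_good B0 (cab n).
  have H1 : (\int[mu]_(w in D) (f w * a_ n w)%:E)%E @[n --> \oo]
    --> (\int[mu]_(w in D) (f w * a w)%:E)%E.
    apply: cvg_integral_EFin => //.
    + by move=> n; have [? ? ? ?] := gd n; exact: measurable_funM.
    + by move=> n w; have [? ? ? ?] := gd n; exact: mulr_ge0.
    + by move=> w m n mn; rewrite ler_wpM2l// nda.
    + by move=> w; apply: cvgM; [exact: cvg_cst|exact: ca].
  have H2 : (\int[mu]_(w in D) (g w * b_ n w)%:E)%E @[n --> \oo]
    --> (\int[mu]_(w in D) (g w * b w)%:E)%E.
    apply: cvg_integral_EFin => //.
    + by move=> n; have [? ? ? ?] := gd n; exact: measurable_funM.
    + by move=> n w; have [? ? ? ?] := gd n; exact: mulr_ge0.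
    + by move=> w m n mn; rewrite ler_wpM2l// ndb.
    + by move=> w; apply: cvgM; [exact: cvg_cst|exact: cb].
  rewrite -(cvg_lim _ H1)// -(cvg_lim _ H2)//.
  by apply: congr_lim; apply/funext => n; exact: E.
Qed.

Lemma closure_pair_prod (mu : {measure set T -> \bar R}) (D : set T)
    (I : eqType) (B : I -> (T -> R) -> (T -> R) -> Prop) (s : seq I)
    (a b : I -> T -> R) : measurable D -> uniq s ->
  (forall i a b, B i a b -> good_pair a b) ->
  (forall a b : I -> T -> R, (forall i, i \in s -> B i (a i) (b i)) ->
    (\int[mu]_(w in D) (\prod_(i <- s) a i w)%:E =
     \int[mu]_(w in D) (\prod_(i <- s) b i w)%:E)%E) ->
  (forall i, i \in s -> closure_pair (B i) (a i) (b i)) ->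
  (\int[mu]_(w in D) (\prod_(i <- s) a i w)%:E =
   \int[mu]_(w in D) (\prod_(i <- s) b i w)%:E)%E.
Proof.
move=> mD us B0 HB ab.
(* Factors indexed by [s1] range over the closure, those indexed by [s2] are still basic; the
   induction moves indices from [s1] to [s2]. *)
suff H s1 s2 : uniq (s1 ++ s2) -> perm_eq (s1 ++ s2) s ->
    forall a b : I -> T -> R,
    (forall i, i \in s1 -> closure_pair (B i) (a i) (b i)) ->
    (forall i, i \in s2 -> B i (a i) (b i)) ->
    (\int[mu]_(w in D) (\prod_(i <- s1 ++ s2) a i w)%:E =
     \int[mu]_(w in D) (\prod_(i <- s1 ++ s2) b i w)%:E)%E.
  by have := H s [::]; rewrite cats0; apply.
elim: s1 s2 {a b ab} => [s2 /= us2 ps2 a b _ ab2|i s1 IH s2].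
  under eq_integral do rewrite (perm_big _ ps2)/=.
  under [RHS]eq_integral do rewrite (perm_big _ ps2)/=.
  by apply: HB => i; rewrite -(perm_mem ps2); exact: ab2.
move=> us12 ps12 a b ab1 ab2; rewrite cat_cons.
have /andP[is12 us12'] : (i \notin s1 ++ s2) && uniq (s1 ++ s2) by [].
have gd j : j \in s1 ++ s2 -> good_pair (a j) (b j).
  rewrite mem_cat => /orP[js|/ab2/B0//].
  by apply: closure_pair_good (ab1 _ _); [exact: B0|rewrite inE js orbT].
under eq_integral do rewrite big_cons mulrC.
  under [RHS]eq_integral do rewrite big_cons mulrC.
apply: (closure_pair_integral (B := B i)) => //; first exact: B0.
- split.
  + by apply: measurable_prod => j /gd[].
  + by apply: measurable_prod => j /gd[].
  + by move=> w; rewrite big_seq prodr_ge0// => j /gd[].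
  + by move=> w; rewrite big_seq prodr_ge0// => j /gd[].
- move=> a0 b0 ab0.
  (* For the factor i it is enough to treat a basic pair [a0], [b0]; with it, i moves to the second
     list and the induction hypothesis applies. *)
  have pi (f : I -> T -> R) f0 w :
      \prod_(j <- s1 ++ i :: s2) (if j == i then f0 else f j) w =
      (\prod_(j <- s1 ++ s2) f j w) * f0 w.
    rewrite (perm_big (i :: s1 ++ s2))/= ?perm_catCA//; last first.
      by rewrite -(cat1s i s2) perm_catCA.
    rewrite big_cons eqxx mulrC; congr (_ * _).
    rewrite big_seq [RHS]big_seq; apply: eq_bigr => j js.
    by case: eqP js is12 => // ->->.
  under eq_integral do rewrite -pi.
  under [RHS]eq_integral do rewrite -pi.
  apply: (IH (i :: s2)).
  + by rewrite -(cat1s i s2) uniq_catCA.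
  + by apply: perm_trans ps12; rewrite -(cat1s i s2) perm_catCA.
  + move=> j js; case: eqP => [ji|_].
      by rewrite mem_cat -ji js in is12.
    by apply: ab1; rewrite inE js orbT.
  + move=> j; rewrite inE; case: eqP => [-> //|_ /= js].
    exact: ab2.
- by apply: ab1; rewrite mem_head.
Qed.

End Closure.

(** * Laplace functionals of Poisson points on an interval *)

Section UnitFunctions.
Context {R : realType}.
Implicit Types (f g h : R -> R).

Definition bounded_borel h := measurable_fun setT h /\ exists M, forall z, 0 <= h z <= M.
Definition unit_borel h := measurable_fun setT h /\ forall z, 0 <= h z <= 1.

Lemma unit_bounded_borel h : unit_borel h -> bounded_borel h.
Proof. by move=> [mh h01]; split => //; exists 1. Qed.

Lemma unit_borelN f : unit_borel f -> unit_borel (fun z => 1 - f z).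
Proof.
move=> [mf f01]; split; first exact: measurable_funB.
by move=> z; have /andP[? ?] := f01 z; rewrite subr_ge0 gerBl; apply/andP.
Qed.

Lemma indic_unit_borel (C : set R) : measurable C -> unit_borel (\1_C).
Proof.
move=> mC; split; first exact: measurable_indic.
by move=> z; rewrite indicE; case: (_ \in _); rewrite ?lexx ler01.
Qed.

Variable x : R.

(** It vanishes when y > x, the interval being empty, so that [laplace] below equals 1 there. *)
Definition itv_int h y := \int[lebesgue_measure]_(z in `[y, x]) h z.

Lemma bounded_borel_integrable h y :
  bounded_borel h -> lebesgue_measure.-integrable `[y, x] (EFin \o h).
Proof.
move=> [mh [M hM]]; apply: measurable_bounded_integrable => //.
- have := lebesgue_measure_itv `[y, x] => /= ->.
  by case: ifPn => // _; rewrite -EFinB ltry.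
- exact: measurable_funTS.
- exists M; split; first by rewrite num_real.
  move=> N MN z _ /=; have /andP[h0 hM'] := hM z.
  by rewrite ger0_norm// (le_trans hM')// ltW.
Qed.

Lemma itv_intD f g y : bounded_borel f -> bounded_borel g ->
  itv_int (fun z => f z + g z) y = itv_int f y + itv_int g y.
Proof. by move=> bf bg; rewrite /itv_int RintegralD//; exact: bounded_borel_integrable. Qed.

Lemma itv_intZ c h y : bounded_borel h ->
  itv_int (fun z => c * h z) y = c * itv_int h y.
Proof. by move=> bh; rewrite /itv_int RintegralZl//; exact: bounded_borel_integrable. Qed.

Lemma itv_int_ge0 h y : (forall z, 0 <= h z) -> 0 <= itv_int h y.
Proof. by move=> h0; exact: Rintegral_ge0. Qed.

Lemma le_itv_int f g y : bounded_borel f -> bounded_borel g ->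
  (forall z, f z <= g z) -> itv_int f y <= itv_int g y.
Proof.
move=> bf bg fg; apply: le_Rintegral => //; exact: bounded_borel_integrable.
Qed.

Lemma itv_intE h y : bounded_borel h ->
  (\int[lebesgue_measure]_(z in `[y, x]) (h z)%:E = (itv_int h y)%:E)%E.
Proof.
move=> bh; rewrite /itv_int /Rintegral fineK//.
by apply: integrable_fin_num => //; exact: bounded_borel_integrable.
Qed.

Lemma itv_int_nonincreasing h y y' : bounded_borel h -> y <= y' ->
  itv_int h y' <= itv_int h y.
Proof.
move=> bh yy'; have [mh [M hM]] := bh.
rewrite -lee_fin -!itv_intE//; apply: ge0_subset_integral => //.
- by apply/measurable_EFinP/measurable_funTS.
- by move=> z _; rewrite lee_fin; have /andP[] := hM z.
- by move=> z; rewrite /= !in_itv/= => /andP[yz ->]; rewrite (le_trans yy').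
Qed.

(** Measurability by monotonicity: for nonnegative h the integral decreases as y grows and the
    interval shrinks. *)
Lemma measurable_itv_int h : bounded_borel h -> measurable_fun setT (itv_int h).
Proof.
move=> bh.
rewrite (_ : itv_int h = -%R \o (fun y => - itv_int h y)); last first.
  by apply/funext => y /=; rewrite opprK.
apply: measurableT_comp => //.
by apply: nondecreasing_measurable => // y y' yy'; rewrite lerN2 itv_int_nonincreasing.
Qed.

Lemma cvg_itv_int (h_ : nat -> R -> R) h y :
  (forall n, bounded_borel (h_ n)) -> bounded_borel h ->
  (forall z, {homo h_^~ z : m n / (m <= n)%N >-> m <= n}) ->
  (forall z, h_^~ z @ \oo --> h z) ->
  itv_int (h_ n) y @[n --> \oo] --> itv_int h y.
Proof.
move=> bh_ bh nd ch.
have : (\int[lebesgue_measure]_(z in `[y, x]) (h_ n z)%:E)%E @[n --> \oo]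
    --> (\int[lebesgue_measure]_(z in `[y, x]) (h z)%:E)%E.
  apply: cvg_integral_EFin => //.
  - by move=> n; have [] := bh_ n.
  - by move=> n z; have [_ [M /(_ z)/andP[]]] := bh_ n.
by rewrite itv_intE// => /fine_cvgP[].
Qed.

Lemma bounded_borelD f g : bounded_borel f -> bounded_borel g ->
  bounded_borel (fun z => f z + g z).
Proof.
move=> [mf [M fM]] [mg [N gN]]; split; first exact: measurable_funD.
exists (M + N) => z; have /andP[? ?] := fM z; have /andP[? ?] := gN z.
by rewrite addr_ge0//= lerD.
Qed.

Lemma bounded_borelZ c h : 0 <= c -> bounded_borel h ->
  bounded_borel (fun z => c * h z).
Proof.
move=> c0 [mh [M hM]]; split; first exact: measurable_funM.
exists (c * M) => z; have /andP[? ?] := hM z.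
by rewrite mulr_ge0//= ler_wpM2l.
Qed.

Lemma bounded_borel0 : bounded_borel (fun=> 0).
Proof. by split => //; exists 0 => z; rewrite lexx. Qed.

Import HBNNSimple.

Lemma simple_sumE (s : seq R) (f : R -> R) z : uniq s -> f z \in s ->
  f z = \sum_(c <- s) c * \1_(f @^-1` [set c]) z.
Proof.
move=> us fs; rewrite (bigD1_seq (f z))//= big1 => [|c /negbTE cf].
  by rewrite indicE mem_set//= mulr1 addr0.
rewrite indicE memNset ?mulr0//= => fc.
by rewrite fc eqxx in cf.
Qed.

Lemma itv_int_simple (s : seq R) (C : R -> set R) y :
  (forall c, c \in s -> 0 <= c) -> (forall c, measurable (C c)) ->
  bounded_borel (fun z => \sum_(c <- s) c * \1_(C c) z) /\
  itv_int (fun z => \sum_(c <- s) c * \1_(C c) z) y =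
    \sum_(c <- s) c * itv_int \1_(C c) y.
Proof.
move=> + mC; elim: s => [|c s IH] s0.
  rewrite big_nil; under eq_fun do rewrite big_nil.
  by split; [exact: bounded_borel0|rewrite /itv_int Rintegral_cst// mul0r].
have c0 : 0 <= c by rewrite s0// mem_head.
have [|bs cs] := IH; first by move=> c' cs; rewrite s0// inE cs orbT.
have bI : bounded_borel (\1_(C c)) by exact/unit_bounded_borel/indic_unit_borel.
under eq_fun do rewrite big_cons.
split; first by apply: bounded_borelD => //; exact: bounded_borelZ.
by rewrite itv_intD ?itv_intZ ?big_cons ?cs//; exact: bounded_borelZ.
Qed.

Lemma simple_unit_approx h : unit_borel h -> exists s_ : nat -> R -> R,
  [/\ forall n, exists2 s : seq R, uniq s & forall c, c \in s <-> exists z, s_ n z = c,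
      forall n, unit_borel (s_ n),
      forall n z, s_ n z <= h z,
      (forall z, {homo s_^~ z : m n / (m <= n)%N >-> m <= n}) &
      (forall z, s_^~ z @ \oo --> h z)].
Proof.
move=> [mh h01].
have mEh : measurable_fun setT (EFin \o h) by exact/measurable_EFinP.
pose s_ := nnsfun_approx measurableT mEh.
have nd z : {homo (fun n => s_ n z) : m n / (m <= n)%N >-> m <= n}.
  by move=> m n mn; exact/lefP/nd_nnsfun_approx.
have cv z : (fun n => s_ n z) @ \oo --> h z.
  have : EFin \o s_^~ z @ \oo --> (EFin \o h) z.
    apply: cvg_nnsfun_approx => // t _.
    by rewrite lee_fin; have /andP[] := h01 t.
  by move=> /fine_cvgP[].
have le n z : s_ n z <= h z.
  rewrite -(cvg_lim _ (cv z))//; apply: nondecreasing_cvgn_le => //.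
  by apply/cvg_ex; exists (h z).
exists (fun n z => s_ n z); split => //.
- move=> n; exists (finmap.enum_fset (fset_set (range (s_ n)))).
    exact: finmap.fset_uniq.
  move=> c; rewrite in_fset_set; last exact: fimfunP.
  rewrite inE/=; split=> [[z _ <-]|[z <-]]; first by exists z.
  by exists z.
- move=> n; split => // z; rewrite fun_ge0/= (le_trans (le n z))//.
  by have /andP[] := h01 z.
Qed.

(** Here [al] and [be] hold the other factors, [Z] is the location of one child and [Y] that of its
    parent. Both sides are linear and monotone in h, so indicators extend to simple functions and
    then to their increasing limits. *)
Lemma closure_pair_fun d (T : measurableType d) B (al be Z Y : T -> R) :
  (forall w, 0 <= al w) -> (forall w, 0 <= be w) ->
  (forall C, measurable C -> closure_pair B
     (fun w => al w * \1_C (Z w)) (fun w => be w * itv_int (\1_C) (Y w))) ->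
  forall h, unit_borel h -> closure_pair B
     (fun w => al w * h (Z w)) (fun w => be w * itv_int h (Y w)).
Proof.
move=> al0 be0 BC h uh.
have [s_ [sim us le nd cv]] := simple_unit_approx uh.
apply: (cl_lim (a_ := fun n w => al w * s_ n (Z w))
               (b_ := fun n w => be w * itv_int (s_ n) (Y w))).
- move=> n; have [s us' sE] := sim n; have [msn sn01] := us n.
  pose C c := s_ n @^-1` [set c].
  have mC c : measurable (C c) by rewrite -[C c]setTI; exact: msn.
  have s0 c : c \in s -> 0 <= c.
    by move=> /sE[z <-]; have /andP[] := sn01 z.
  have -> : s_ n = fun z => \sum_(c <- s) c * \1_(C c) z.
    by apply/funext => z; apply: simple_sumE => //; apply/sE; exists z.
  apply: (closure_pair_ext (a := fun w => \sum_(c <- s) c * (al w * \1_(C c) (Z w)))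
    (b := fun w => \sum_(c <- s) c * (be w * itv_int \1_(C c) (Y w)))).
  + elim: s s0 {us' sE} => [|c s IH] s0.
      by apply: (closure_pair_ext (cl_zero B)) => w; rewrite big_nil.
    have c0 : 0 <= c by rewrite s0// mem_head.
    have {}IH : closure_pair _ _ _ := IH (fun c' cs => s0 c' (mem_behead (s := c :: s) cs)).
    by apply: (closure_pair_ext (cl_add (cl_scale c0 (BC _ (mC c))) IH)) => w; rewrite big_cons.
  + by move=> w; rewrite mulr_sumr; apply: eq_bigr => c _; rewrite mulrCA.
  + move=> w; rewrite (itv_int_simple _ s0 mC).2 mulr_sumr.
    by apply: eq_bigr => c _; rewrite mulrCA.
- by move=> w m n mn; rewrite ler_wpM2l// nd.
- move=> w m n mn; rewrite ler_wpM2l// le_itv_int//.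
  + exact: unit_bounded_borel.
  + exact: unit_bounded_borel.
  + by move=> z; exact: nd.
- by move=> w; apply: cvgM; [exact: cvg_cst|exact: cv].
- move=> w; apply: cvgM; first exact: cvg_cst.
  apply: cvg_itv_int => //; last exact: unit_bounded_borel.
  by move=> n; exact: unit_bounded_borel.
Qed.

End UnitFunctions.

Section PoissonPoints.
Context {R : realType} (x : R).

Definition itv_len (y : R) := itv_int x (fun=> 1) y.

(* the Laplace functional of the Poisson process of unit intensity on [y, x] *)
Definition laplace (g : R -> R) (y : R) := expR (- itv_int x (fun z => 1 - g z) y).

Lemma itv_lenE y : itv_len y = Num.max 0 (x - y).
Proof.
rewrite /itv_len /itv_int Rintegral_cst//= lebesgue_measure_itv/= lte_fin.
have [yx|xy] := ltP y x; rewrite mul1r /=.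
  by rewrite max_r// subr_ge0 ltW.
by rewrite max_l// subr_le0.
Qed.

Lemma bounded_borel1 : bounded_borel (fun _ : R => 1 : R).
Proof. by split => //; exists 1 => z; rewrite lexx ler01. Qed.

(** Isolates the exponential of the integral of g, whose power series is the decomposition according
    to the number of points. *)
Lemma laplaceE g y : unit_borel g ->
  laplace g y = expR (- itv_len y) * expR (itv_int x g y).
Proof.
move=> ug; rewrite -expRD; congr expR.
have /(congr1 -%R) : itv_int x (fun z => (1 - g z) + g z) y =
    itv_int x (fun z => 1 - g z) y + itv_int x g y.
  by apply: itv_intD; apply: unit_bounded_borel => //; exact: unit_borelN.
under [in X in - X]eq_fun do rewrite subrK.
by rewrite -/(itv_len y) => ->; rewrite opprD subrK.
Qed.

Lemma itv_int_indic (C : set R) y : measurable C ->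
  lebesgue_measure (C `&` `[y, x]) = (itv_int x \1_C y)%:E.
Proof.
move=> mC; rewrite -itv_intE; last exact/unit_bounded_borel/indic_unit_borel.
by rewrite integral_indic.
Qed.

Lemma uniform_lawE y (C : set R) : measurable C -> y < x ->
  uniform_law y x C = ((x - y)^-1 * itv_int x \1_C y)%:E.
Proof.
move=> mC yx; rewrite /uniform_law integral_uniform_pdf.
under eq_integral.
  move=> z; rewrite inE => -[_]; rewrite /= in_itv/= /uniform_pdf => -> .
  over.
rewrite /= integral_cst//; last exact: measurableI.
by rewrite EFinM; congr (_ * _)%E; exact: itv_int_indic.
Qed.

(** The power (x - y)^k in the Poisson weight cancels the k densities 1/(x - y) of the uniform laws.
    For y >= x both sides are 1 at k = 0 and 0 otherwise, the integrals being over a null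
    interval. *)
Lemma poisson_uniformE y k (C : nat -> set R) : (forall i, measurable (C i)) ->
  (poisson_weight (x - y) k * \big[*%E/1]_(i < k) uniform_law y x (C i) =
   (expR (- itv_len y) / k`!%:R * \prod_(i < k) itv_int x \1_(C i) y)%:E)%E.
Proof.
move=> mC; rewrite /poisson_weight /poisson_prob subr_gt0 itv_lenE.
case: ifPn => [yx|]; last rewrite -leNgt => xy.
  rewrite esum_set1 ?lee_fin ?poisson_pmf_ge0// /poisson_pmf subr_gt0 yx.
  under eq_bigr do rewrite uniform_lawE//.
  rewrite prodEFin -EFinM big_split/= prodr_const card_ord; congr EFin.
  rewrite max_r ?subr_ge0 1?ltW// exprVn.
  have : (x - y) ^+ k != 0 by rewrite expf_neq0// subr_eq0 gt_eqF.
  move: (k`!%:R^-1) (expR _) (\prod_(_ < _) _) (_ ^+ _) => a b c e e0.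
  by field.
rewrite max_l ?subr_le0// oppr0 expR0 diracE.
case: k => [|k].
  by rewrite !big_ord0 mem_set//= fact0 mule1 divr1 mulr1.
rewrite memNset//= mul0e big_ord_recl (_ : itv_int _ _ _ = 0) ?mul0r ?mulr0//.
apply/le_anti/andP; split; last first.
  by apply: itv_int_ge0 => z; rewrite indicE.
apply: (@le_trans _ _ (itv_int x (fun=> 1) y)); [apply: le_itv_int|].
- exact/unit_bounded_borel/indic_unit_borel.
- exact: bounded_borel1.
- by move=> z; rewrite indicE; case: (_ \in _); rewrite ?lexx ?ler01.
- by rewrite -/(itv_len y) itv_lenE max_l// subr_le0.
Qed.

Context d (T : measurableType d) (M : T -> nat) (Z : nat -> T -> R) (Y : T -> R).

(* The second component is the conditional expectation of the first one, M being
   the number of children of a point at Y and Z their locations. *)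
Definition offspring_pair (a b : T -> R) := exists k (C : nat -> set R),
  [/\ forall i, measurable (C i),
      a = (fun w => (M w == k)%:R * \prod_(i < k) \1_(C i) (Z i w)) &
      b = (fun w => expR (- itv_len (Y w)) / k`!%:R *
                    \prod_(i < k) itv_int x \1_(C i) (Y w))].

(** Induction on j, the number of leading test functions allowed to be arbitrary; from index j on
    they are indicators. Each step frees one more by [closure_pair_fun]. *)
Lemma offspring_pair_fun j k (h : nat -> R -> R) :
  (forall i, (i < j)%N -> unit_borel (h i)) ->
  (forall i, (j <= i)%N -> exists2 C, measurable C & h i = \1_C) ->
  closure_pair offspring_pair
    (fun w => (M w == k)%:R * \prod_(i < k) h i (Z i w))
    (fun w => expR (- itv_len (Y w)) / k`!%:R * \prod_(i < k) itv_int x (h i) (Y w)).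
Proof.
elim: j h => [h _ hC|j IH h hu hC].
  apply: cl_basic.
  have /choice[C CE] : forall i, exists C, measurable C /\ h i = \1_C.
    by move=> i; have [C mC hE] := hC i isT; exists C.
  exists k, C; split.
  - by move=> i; have [] := CE i.
  - by apply/funext => w; congr (_ * _); apply: eq_bigr => i _; have [_ ->] := CE i.
  - by apply/funext => w; congr (_ * _); apply: eq_bigr => i _; have [_ ->] := CE i.
pose h' f i := if i == j then f else h i.
have hu' f i : (i < j)%N -> unit_borel (h' f i).
  move=> ij; rewrite /h'; case: eqP => [e|_]; first by rewrite e ltnn in ij.
  exact/hu/ltnW.
have hC' C i : measurable C -> (j <= i)%N -> exists2 C', measurable C' & h' \1_C i = \1_C'.
  move=> mC ji; rewrite /h'; case: eqP => [e|/eqP ij]; first by exists C.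
  by apply: hC; rewrite ltn_neqAle eq_sym ij.
(* If k <= j, the j-th function does not occur in the product, and [\1_setT] can stand in for it. *)
have [kj|jk] := leqP k j.
  have E i : (i < k)%N -> h' \1_setT i = h i.
    move=> ik; rewrite /h'; case: eqP => // e.
    by have := leq_trans ik kj; rewrite e ltnn.
  apply: (closure_pair_ext (IH _ (hu' \1_setT) (fun i => hC' _ i measurableT))) => w.
    by congr (_ * _); apply: eq_bigr => i _; rewrite E.
  by congr (_ * _); apply: eq_bigr => i _; rewrite E.
have bD f (F : (R -> R) -> nat -> R) : \prod_(i < k) F (h' f i) i =
    (\prod_(i < k | i != Ordinal jk) F (h i) i) * F f j.
  rewrite (bigD1 (Ordinal jk))//= {1}/h' eqxx mulrC; congr (_ * _).
  by apply: eq_bigr => i; rewrite -val_eqE/= /h' => /negbTE ->.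
have hE : h = h' (h j).
  by apply/funext => i; rewrite /h'; case: eqP => // ->.
have ge0h i z : 0 <= h i z.
  have [/hu[_ /(_ z)/andP[]]//|/hC[C _ ->]] := ltnP i j.+1.
  by rewrite indicE.
have := @closure_pair_fun _ x _ _ offspring_pair
  (fun w => (M w == k)%:R * \prod_(i < k | i != Ordinal jk) h i (Z i w))
  (fun w => expR (- itv_len (Y w)) / k`!%:R *
     \prod_(i < k | i != Ordinal jk) itv_int x (h i) (Y w)) (Z j) Y.
move=> /(_ _ _ _ (h j) (hu j (ltnSn j))) H.
apply: (closure_pair_ext (H _ _ _)).
- by move=> w; rewrite mulr_ge0// prodr_ge0.
- move=> w; rewrite mulr_ge0// ?divr_ge0 ?expR_ge0//.
  by apply: prodr_ge0 => i _; exact: itv_int_ge0.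
- move=> C mC.
  apply: (closure_pair_ext (IH _ (hu' \1_C) (fun i => hC' _ i mC))) => w.
    by rewrite (bD _ (fun f i => f (Z i w))) mulrA.
  by rewrite (bD _ (fun f i => itv_int x f (Y w))) mulrA.
- by move=> w; rewrite [in RHS]hE (bD _ (fun f i => f (Z i w))) mulrA.
- by move=> w; rewrite [in RHS]hE (bD _ (fun f i => itv_int x f (Y w))) mulrA.
Qed.

Lemma cvg_exp_sum (c r : R) :
  (\sum_(k < n) c / k`!%:R * r ^+ k) @[n --> \oo] --> c * expR r.
Proof.
have -> : (fun n => \sum_(k < n) c / k`!%:R * r ^+ k) =
    (fun n => c * series (exp_coeff r) n).
  apply/funext => n; rewrite seriesEord/= mulr_sumr; apply: eq_bigr => k _.
  by rewrite /exp_coeff/= mulrAC mulrA.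
apply: cvgM; [exact: cvg_cst|exact: is_cvg_series_exp_coeff].
Qed.

Lemma cvg_sum_select (F : nat -> R) (m : nat) :
  (\sum_(k < n) (m == k :> nat)%:R * F k) @[n --> \oo] --> F m.
Proof.
apply: cvg_near_cst; exists m.+1 => // n /= mn.
rewrite (bigD1 (Ordinal mn))//= eqxx mul1r big1 ?addr0// => i.
by rewrite -val_eqE/= eq_sym => /negbTE ->; rewrite mul0r.
Qed.

Lemma homo_sum (u : nat -> R) : (forall n, 0 <= u n) ->
  {homo (fun n => \sum_(k < n) u k) : m n / (m <= n)%N >-> m <= n}.
Proof.
move=> u0 m n mn; rewrite -!(big_mkord xpredT) (big_cat_nat (leq0n m) mn)/= lerDl.
exact: sumr_ge0.
Qed.

(** Decomposition by the number k of children. On the left at most one term of the sum over k is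
    nonzero; on the right the sum is the exponential series of the integral of g. *)
Lemma offspring_pair_laplace (g : R -> R) : unit_borel g ->
  closure_pair offspring_pair
    (fun w => \prod_(i < M w) g (Z i w)) (fun w => laplace g (Y w)).
Proof.
move=> ug; have [_ g01] := ug.
have g0 z : 0 <= g z by have /andP[] := g01 z.
apply: (cl_lim
  (a_ := fun n w => \sum_(k < n) (M w == k)%:R * \prod_(i < k) g (Z i w))
  (b_ := fun n w => \sum_(k < n) expR (- itv_len (Y w)) / k`!%:R *
                      itv_int x g (Y w) ^+ k)).
- move=> n; apply: (closure_pair_sum
    (a := fun k w => (M w == k)%:R * \prod_(i < k) g (Z i w))
    (b := fun k w => expR (- itv_len (Y w)) / k`!%:R * itv_int x g (Y w) ^+ k)) => k.
  (* [offspring_pair_fun] wants indicators from index k on, hence the padding. *)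
  pose h i : R -> R := if (i < k)%N then g else \1_setT.
  have := @offspring_pair_fun k k h.
  move=> H; apply: (closure_pair_ext (H _ _)) => [i|i|w|w]; rewrite /h.
  + by move=> ->.
  + by rewrite ltnNge => ->; exists setT.
  + by congr (_ * _); apply: eq_bigr => i _; rewrite ltn_ord.
  + congr (_ * _); rewrite -[X in _ ^+ X]card_ord -prodr_const.
    by apply: eq_bigr => i _; rewrite ltn_ord.
- move=> w; apply: (homo_sum
    (u := fun k => (M w == k)%:R * \prod_(i < k) g (Z i w))) => k.
  by rewrite mulr_ge0// prodr_ge0.
- move=> w; apply: (homo_sum
    (u := fun k => expR (- itv_len (Y w)) / k`!%:R * itv_int x g (Y w) ^+ k)) => k.
  rewrite mulr_ge0 ?divr_ge0 ?expR_ge0//.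
  by rewrite exprn_ge0// itv_int_ge0.
- by move=> w; exact: (cvg_sum_select (F := fun k => \prod_(i < k) g (Z i w))).

- by move=> w; rewrite laplaceE//; exact: cvg_exp_sum.
Qed.

Lemma unit_borel_laplace (g : R -> R) : unit_borel g -> unit_borel (laplace g).
Proof.
move=> ug; have ub := unit_borelN ug.
have i0 y : 0 <= itv_int x (fun z => 1 - g z) y.
  by apply: itv_int_ge0 => z; have [_ /(_ z)/andP[]] := ub.
split; last first.
  by move=> y; rewrite expR_ge0/= -expR0 ler_expR oppr_le0.
apply: measurableT_comp => //; apply: measurableT_comp => //.
by apply: measurable_itv_int; exact: unit_bounded_borel.
Qed.

End PoissonPoints.

(** * The continuum cascade *)

Section DiscreteMeasurability.
Context d (T : measurableType d).

(** Stated through fibres so that I needs no sigma-algebra; for countable I this yields all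
    preimages. *)
Definition discrete_measurable (I : Type) (phi : T -> I) :=
  forall i, measurable [set w | phi w = i].

Lemma discrete_measurable_cst (I : Type) (i : I) : discrete_measurable (fun=> i).
Proof.
move=> j; have [->|ij] := pselect (i = j).
  by rewrite (_ : [set _ | _] = setT)//; apply/seteqP.
by rewrite (_ : [set _ | _] = set0)//; apply/seteqP; split.
Qed.

Lemma discrete_measurable_bind (I : countType) (J : Type) (phi : T -> I)
    (psi : I -> T -> J) : discrete_measurable phi ->
  (forall i, discrete_measurable (psi i)) ->
  discrete_measurable (fun w => psi (phi w) w).
Proof.
move=> mphi mpsi j.
rewrite (_ : [set _ | _] =
    \bigcup_i ([set w | phi w = i] `&` [set w | psi i w = j])); last first.
  apply/seteqP; split => w /=; first by move=> wj; exists (phi w).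
  by move=> [i _ [-> ]].
apply: countable_bigcupT_measurable => //.
by move=> i; apply: measurableI; [exact: mphi|exact: mpsi].
Qed.

Lemma integral_discrete_partition (R : realType) (mu : {measure set T -> \bar R})
    (I : countType) (phi : T -> I) (f g : T -> R) : discrete_measurable phi ->
  measurable_fun setT f -> measurable_fun setT g ->
  (forall w, 0 <= f w) -> (forall w, 0 <= g w) ->
  (forall i, \int[mu]_(w in [set w | phi w = i]) (f w)%:E =
             \int[mu]_(w in [set w | phi w = i]) (g w)%:E)%E ->
  (\int[mu]_w (f w)%:E = \int[mu]_w (g w)%:E)%E.
Proof.
move=> mphi mf mg f0 g0 fg.
pose F n := [set w | pickle (phi w) = n].
have FE n : F n = set0 \/ exists i, F n = [set w | phi w = i].
  have [[w Fw]|Fn] := pselect (F n !=set0); last first.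
    by left; apply: contrapT => /eqP/set0P.
  right; exists (phi w); rewrite -Fw; apply/seteqP; split => t /=.
    exact: (pcan_inj pickleK).
  by rewrite /F/= => ->.
have mF n : measurable (F n) by have [->|[i ->]] := FE n.
have UF : \bigcup_n F n = setT.
  by apply/seteqP; split => // w _; exists (pickle (phi w)).
have tF : trivIset setT F.
  apply/trivIsetP => m n _ _ /eqP mn; apply/seteqP; split => // w [wm wn].
  by apply: mn; rewrite -wm -wn.
rewrite -UF !ge0_integral_bigcup//; last 4 first.
- by rewrite UF; exact/measurable_EFinP.
- by move=> w _; rewrite lee_fin.
- by rewrite UF; exact/measurable_EFinP.
- by move=> w _; rewrite lee_fin.
apply: eq_eseriesr => n _; have [->|[i ->]] := FE n.
  by rewrite !integral_set0.
exact: fg.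
Qed.

Lemma measurable_fun_discrete (I : countType) (R : realType) (phi : T -> I)
    (f : I -> T -> R) : discrete_measurable phi ->
  (forall i, measurable_fun setT (f i)) ->
  measurable_fun setT (fun w => f (phi w) w).
Proof.
move=> mphi mf _ B mB; rewrite setTI.
rewrite (_ : _ @^-1` _ =
    \bigcup_i ([set w | phi w = i] `&` (f i @^-1` B))); last first.
  apply/seteqP; split => w /=; first by move=> wj; exists (phi w).
  by move=> [i _ [-> ]].
apply: countable_bigcupT_measurable => //.
move=> i; apply: measurableI => //.
by rewrite -[X in measurable X]setTI; exact: mf.
Qed.

End DiscreteMeasurability.

Lemma countable_bigcapT_measurable d (T : measurableType d) (I : countType)
    (F : I -> set T) :
  (forall i, measurable (F i)) -> measurable (\bigcap_i F i).
Proof.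
move=> mF; rewrite -[X in measurable X]setCK setC_bigcap; apply: measurableC.
by apply: countable_bigcupT_measurable => // i; exact: measurableC.
Qed.

(** * Generations and height of a tree *)

Section CascadeTree.
Context {T : Type} (N : label -> T -> nat).

Lemma step_flatten u w :
  step N u.+1 w = [seq rcons v i | v <- step N u w, i <- iota 0 (N v w)].
Proof. by []. Qed.

Lemma uniq_step u w : uniq (step N u w).
Proof.
elim: u => [//|u IH]; rewrite step_flatten.
apply: allpairs_uniq_dep => //; first by move=> v _; exact: iota_uniq.
by move=> [v i] [v' i'] _ _ /= /rcons_inj[-> ->].
Qed.

Lemma mem_stepS u w v i : (rcons v i \in step N u.+1 w) =
  (v \in step N u w) && (i < N v w)%N.
Proof.
rewrite step_flatten; apply/allpairsPdep/andP => /=.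
  move=> [v' [i' [v'u]]]; rewrite mem_iota/= add0n => i'N /rcons_inj[-> ->].
  by [].
by move=> [vu iN]; exists v, i; rewrite mem_iota/= add0n.
Qed.

(** Step u consists of the endpoints of the paths of u edges from the root, and a path with more
    than n edges has an initial segment with exactly n + 1. *)
Lemma height_le (R : realType) n w :
  (height N R w <= n%:R%:E)%E <-> step N n.+1 w = [::].
Proof.
have stepP u v : v \in step N u w <->
    exists p, [/\ path (edge N w) [::] p, size p = u & last [::] p = v].
  elim: u v => [|u IH] v; split.
  - by rewrite inE => /eqP ->; exists [::].
  - by move=> [p [_ /size0nil -> /= <-]]; rewrite inE.
  - case/lastP: v => [|v i].
      by rewrite step_flatten => /allpairsPdep[[|? ?] [? []]].
    rewrite mem_stepS => /andP[/IH[p [pp sp lp]] iN].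
    exists (rcons p (rcons v i)); rewrite size_rcons sp last_rcons; split => //.
    rewrite rcons_path pp lp /edge /children.
    by apply/mapP; exists i; rewrite // mem_iota.
  - move=> [p []]; case/lastP: p => // p v'.
    rewrite rcons_path size_rcons last_rcons => /andP[pp ev] [sp] <-.
    move: ev; rewrite /edge /children => /mapP[i]; rewrite mem_iota/= add0n => iN ->.
    by rewrite mem_stepS iN andbT; apply/IH; exists p.
split => [hn|sn].
  case E : (step N n.+1 w) => [//|v s].
  have /stepP[p [pp sp _]] : v \in step N n.+1 w by rewrite E mem_head.
  have : ((size p)%:R%:E <= height N R w)%E.
    by apply: ereal_sup_ubound; exists p.
  by move=> /le_trans/(_ hn); rewrite lee_fin ler_nat sp ltnn.
apply: ge_ereal_sup => _ [p /= pp <-]; rewrite lee_fin ler_nat leqNgt.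
apply/negP => np.
have : last [::] (take n.+1 p) \in step N n.+1 w.
  apply/stepP; exists (take n.+1 p); split => //; first exact: take_path.
  by rewrite size_takel.
by rewrite sn.
Qed.

End CascadeTree.

Section CascadeExtinction.
Context {R : realType} d (T : measurableType d) (P : probability T R) (x : R)
  (N : label -> {RV P >-> nat}) (X : label -> {RV P >-> R}).

Lemma discrete_measurable_step u : discrete_measurable (step N u).
Proof.
elim: u => [|u IH]; first exact: discrete_measurable_cst.
apply: (discrete_measurable_bind
  (psi := fun s w => flatten [seq children N w v | v <- s]) IH) => s.
elim: s => [|v s IHs]; first exact: discrete_measurable_cst.
apply: (discrete_measurable_bind
  (psi := fun k w => [seq rcons v i | i <- iota 0 k] ++
     flatten [seq children N w v | v <- s]) (phi := N v)).
  by move=> k; exact: (measurable_funPTI (N v) (Y := [set k])).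
move=> k; apply: (discrete_measurable_bind
  (psi := fun s' _ => [seq rcons v i | i <- iota 0 k] ++ s') IHs) => s'.
exact: discrete_measurable_cst.
Qed.

Hypothesis NX : continuum_cascade P x N X.

Local Notation offspring v := (offspring_pair x (N v) (fun i => X (rcons v i)) (X v)).

Lemma offspring_pair_good v a b : offspring v a b -> good_pair a b.
Proof.
move=> [k [C [mC -> ->]]].
have mI : measurable_fun setT (fun w => ((N v w == k)%:R : R)).
  have -> : (fun w => ((N v w == k)%:R : R)) = \1_(N v @^-1` [set k]).
    apply/funext => w; rewrite indicE; congr (nat_of_bool _)%:R.
    by apply/eqP/idP; rewrite inE.
  apply: measurable_indic.
  exact: (measurable_funPTI (N v) (Y := [set k])).
have mlen : measurable_fun setT (fun w => itv_len x (X v w)).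
  under eq_fun do rewrite itv_lenE.
  by apply: measurable_maxr => //; apply: measurable_funB => //; exact: measurable_funP.
have mitv i : measurable_fun setT (fun w => itv_int x \1_(C i) (X v w)).
  have mitv := measurable_itv_int x (unit_bounded_borel (indic_unit_borel (mC i))).
  exact: measurableT_comp.
split.
- apply: measurable_funM => //; apply: (measurable_prod
    (h := fun (i : 'I_k) w => \1_(C i) (X (rcons v i) w))) => i _.
  have [mCi _] := indic_unit_borel (mC i).
  exact: measurableT_comp.
- apply: measurable_funM; last first.
    by apply: (measurable_prod
      (h := fun (i : 'I_k) w => itv_int x \1_(C i) (X v w))) => i _; exact: mitv.
  apply: measurable_funM => //; apply: measurableT_comp => //.
  exact: measurableT_comp.
- by move=> w; rewrite mulr_ge0// prodr_ge0// => i _; rewrite indicE.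
- move=> w; rewrite mulr_ge0 ?divr_ge0 ?expR_ge0//.
  by apply: prodr_ge0 => i _; apply: itv_int_ge0 => z; rewrite indicE.
Qed.

(** Basic factors are what [cascade_law] speaks of: with A the whole space, the product of the [a v]
    is the indicator of its event and, by [poisson_uniformE], the product of the [b v] is its
    integrand. *)
Lemma cascade_law_pair u (S : seq label) (a b : label -> T -> R) :
  (forall v, v \in S -> offspring v (a v) (b v)) ->
  (\int[P]_(w in [set w | step N u w = S]) (\prod_(v <- S) a v w)%:E =
   \int[P]_(w in [set w | step N u w = S]) (\prod_(v <- S) b v w)%:E)%E.
Proof.
move=> ab.
have /choice[kC kCE] : forall v, exists kC : nat * (nat -> set R),
    (forall i, measurable (kC.2 i)) /\ (v \in S ->
      a v = (fun w => (N v w == kC.1)%:R * \prod_(i < kC.1) \1_(kC.2 i) (X (rcons v i) w)) /\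
      b v = (fun w => expR (- itv_len x (X v w)) / kC.1`!%:R *
                    \prod_(i < kC.1) itv_int x \1_(kC.2 i) (X v w))).
  move=> v; have [vS|vS] := boolP (v \in S); last first.
    by exists (0%N, fun=> setT); split => [i|]; [exact: measurableT|move: vS => /negP].
  by have [k [C [mC aE bE]]] := ab _ vS; exists (k, C).
have mC v i : measurable ((kC v).2 i) by have [] := kCE v.
have := cascade_law NX (u := u) (A := setT) S (fun v => (kC v).1) _ mC.
pose E := [set w | forall v, v \in S -> N v w = (kC v).1 /\
  forall i, (i < (kC v).1)%N -> (kC v).2 i (X (rcons v i) w)].
have aE w : \prod_(v <- S) a v w = \1_E w.
  rewrite indicE; have [wE|wE] := boolP (w \in E).
    rewrite big_seq big1// => v vS; have [_ /(_ vS)[-> _]] := kCE v.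
    move/set_mem : wE => /(_ v vS)[-> wC]; rewrite eqxx mul1r big1// => i _.
    by rewrite indicE mem_set//; exact: wC.
  have /existsNP[v /not_implyP[vS nv]] : ~ E w.
    by move=> Ew; move: wE; rewrite mem_set.
  apply/eqP; rewrite prodf_seq_eq0.
  apply/hasP; exists v => //=; have [_ /(_ vS)[-> _]] := kCE v.
  have [Nk|_] := eqVneq (N v w) (kC v).1; last by rewrite mul0r.
  have /existsNP[i /not_implyP[ik Ci]] := fun h => nv (conj Nk h).
  rewrite mulf_eq0; apply/orP; right; apply/prodf_eq0.
  by exists (Ordinal ik) => //=; rewrite indicE memNset.
(* The event inherits measurability from its indicator, a finite product of measurable functions. *)
have mE : measurable E.
  rewrite (_ : E = setT `&` (fun w => \prod_(v <- S) a v w) @^-1` [set 1]).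
    apply: measurable_prod => // v /ab /offspring_pair_good[].
    by [].
  rewrite setTI; apply/seteqP; split => w /=; rewrite aE indicE.
    by move=> Ew; rewrite mem_set.
  by case: (boolP (w \in E)) => [/set_mem//|_ /eqP]; rewrite eq_sym oner_eq0.
rewrite !setTI => law.
under eq_integral do rewrite aE.
rewrite integral_indic//; last exact: discrete_measurable_step.
rewrite setIC; apply: (etrans (law _)).
  (* The whole space belongs to [history], as the complement of the empty set. *)
  have [h0 hD _] := smallest_sigma_algebra setT
    ([set E | exists v B, [/\ (size v <= u)%N, measurable B &
         E = [set w | v \in step N (size v) w /\ B (X v w)] ] ]).
  by rewrite -(setD0 setT); exact: hD.
apply: eq_integral => w _; rewrite /=  -prodEFin big_seq [RHS]big_seq.
apply: eq_bigr => v vS; have [_ /(_ vS)[_ ->]] := kCE v.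
by rewrite poisson_uniformE.
Qed.

Lemma cascade_step_laplace u (g : R -> R) : unit_borel g ->
  (\int[P]_w (\prod_(v <- step N u.+1 w) g (X v w))%:E =
   \int[P]_w (\prod_(v <- step N u w) laplace x g (X v w))%:E)%E.
Proof.
move=> ug; have [mg g01] := ug; have [ml l01] := unit_borel_laplace x ug.
have g0 z : 0 <= g z by have /andP[] := g01 z.
have l0 z : 0 <= laplace x g z by have /andP[] := l01 z.
have mX (h : R -> R) v : measurable_fun setT h -> measurable_fun setT (fun w => h (X v w)).
  by move=> mh; exact: (measurableT_comp mh (measurable_funP (X v))).
apply: (integral_discrete_partition (phi := step N u)).
- exact: discrete_measurable_step.
- apply: (measurable_fun_discrete
    (f := fun s w => \prod_(v <- s) g (X v w)) (discrete_measurable_step u.+1)) => s.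
  by apply: measurable_prod => v _; exact: mX.
- apply: (measurable_fun_discrete
    (f := fun s w => \prod_(v <- s) laplace x g (X v w)) (discrete_measurable_step u)) => s.
  by apply: measurable_prod => v _; exact: mX.
- by move=> w; rewrite prodr_ge0.
- by move=> w; rewrite prodr_ge0.
(* On each piece the list S is fixed; a nonempty piece certifies that S is duplicate-free, as
   [closure_pair_prod] demands. *)
move=> S; have [[w0 /= w0S]|nS] := pselect ([set w | step N u w = S] !=set0); last first.
  suff -> : [set w | step N u w = S] = set0 by rewrite !integral_set0.
  by apply: contrapT => /eqP/set0P.
transitivity (\int[P]_(w in [set w | step N u w = S])
    (\prod_(v <- S) \prod_(i < N v w) g (X (rcons v i) w))%:E)%E.
  apply: eq_integral => w; rewrite inE => wS; congr EFin.
  have {}wS : step N u w = S := wS.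
  rewrite -/(step N u.+1 w) step_flatten wS big_allpairs_dep; apply: eq_bigr => v _.
  by rewrite -(big_mkord xpredT (fun i => g (X (rcons v i) w))) /index_iota subn0.
under [RHS]eq_integral => w.
  rewrite inE /= => ->; over.
apply: (closure_pair_prod (B := fun v => offspring v)).
- exact: discrete_measurable_step.
- by rewrite -w0S uniq_step.
- exact: offspring_pair_good.
- by move=> a b ab; exact: cascade_law_pair.
- by move=> v _; exact: offspring_pair_laplace.
Qed.

(** A product of zeros over a list is the indicator that the list is empty, which starts the
    induction; each further application of [laplace] lowers by one the step over which the product
    is taken. *)
Lemma cascade_extinction m u : P [set w | step N (u + m) w = [::]] =
  (\int[P]_w (\prod_(v <- step N u w) iter m (laplace x) (fun=> 0) (X v w))%:E)%E.
Proof.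
elim: m u => [|m IH] u /=.
  rewrite addn0 -(setIT [set _ | _]) -integral_indic//; last exact: discrete_measurable_step.
  apply: eq_integral => w _; congr EFin; rewrite indicE.
  case E : (step N u w) => [|v s]; first by rewrite mem_set// big_nil.
  by rewrite memNset/= ?E// big_cons mul0r.
rewrite addnS -addSn IH -cascade_step_laplace//.
elim: m {IH} => [|m IH] /=; last exact: unit_borel_laplace.
by split => // z; rewrite lexx ler01.
Qed.

Lemma cascade_height_le n :
  P [set w | (height N R w <= n%:R%:E)%E] =
  (iter n.+1 (laplace x) (fun=> 0) 0)%:E.
Proof.
rewrite (_ : [set _ | _] = [set w | step N (0 + n.+1) w = [::]]); last first.
  by apply/seteqP; split => w /=; rewrite height_le.
rewrite cascade_extinction.
under eq_integral do rewrite /= big_seq1 (cascade_root NX).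
rewrite integral_cst// -[RHS]mule1; congr (_ * _)%E; exact: probability_setT.
Qed.

End CascadeExtinction.

(** * The Laplace functional of a Poisson process *)

Section InfiniteProducts.
Context {R : realType}.
Implicit Types (u : nat -> R).

Definition infprod u := limn (fun K => \prod_(i < K) u i).

Lemma prod01 (I : finType) (P : pred I) (u : I -> R) :
  (forall i, 0 <= u i <= 1) -> 0 <= \prod_(i | P i) u i <= 1.
Proof.
move=> u01; apply/andP; split.
  by apply: prodr_ge0 => i _; have /andP[] := u01 i.
by apply: prodr_ile1 => i _; exact: u01.
Qed.

Lemma nonincreasing_prod u : (forall i, 0 <= u i <= 1) ->
  {homo (fun K => \prod_(i < K) u i) : m n / (m <= n)%N >-> n <= m}.
Proof.
move=> u01 m n; elim: n => [|n IH]; first by rewrite leqn0 => /eqP ->.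
rewrite leq_eqVlt => /predU1P[-> //|/IH]; apply: le_trans.
rewrite big_ord_recr/= ler_piMr//; last by have /andP[] := u01 n.
by have /andP[] := @prod01 _ xpredT (fun i : 'I_n => u i) (fun i => u01 i).
Qed.

Lemma cvg_infprod u : (forall i, 0 <= u i <= 1) ->
  \prod_(i < K) u i @[K --> \oo] --> infprod u.
Proof.
move=> u01; apply: nonincreasing_is_cvgn; first exact: nonincreasing_prod.
exists 0 => _ [K _ <-].
by have /andP[] := @prod01 _ xpredT (fun i : 'I_K => u i) (fun i => u01 i).
Qed.

Lemma infprod_le u K : (forall i, 0 <= u i <= 1) -> infprod u <= \prod_(i < K) u i.
Proof.
move=> u01; apply: (nonincreasing_cvgn_ge (nonincreasing_prod u01)).
by apply/cvg_ex; exists (infprod u); exact: cvg_infprod.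
Qed.

Lemma infprod01 u : (forall i, 0 <= u i <= 1) -> 0 <= infprod u <= 1.
Proof.
move=> u01; apply/andP; split.
  apply: (cvgn_ge0 _ (cvg_infprod u01)) => K.
  by have /andP[] := @prod01 _ xpredT (fun i : 'I_K => u i) (fun i => u01 i).
by have := infprod_le 0 u01; rewrite big_ord0.
Qed.

(** Only an upper estimate is at stake, since the infinite product of u is below that of [u_ n]. The
    latter is below any partial product, which is continuous in its finitely many factors: K is
    chosen for u alone, then n for the first K factors. *)
Lemma cvg_infprod_nonincreasing (u_ : nat -> nat -> R) u :
  (forall n i, 0 <= u_ n i <= 1) -> (forall i, 0 <= u i <= 1) ->
  (forall n i, u i <= u_ n i) -> (forall i, u_^~ i @ \oo --> u i) ->
  infprod (u_ n) @[n --> \oo] --> infprod u.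
Proof.
move=> u_01 u01 uu_ cu.
have le n : infprod u <= infprod (u_ n).
  apply: (ler_cvgn _ (cvg_infprod u01) (cvg_infprod (u_01 n))) => K.
  by apply: ler_prod => i _; rewrite uu_; have /andP[->] := u01 i.
apply/cvgrPdist_lt => e e0.
have e20 : 0 < e / 2 by rewrite divr_gt0.
have /cvgrPdist_lt/(_ (e / 2) e20)[K _ /(_ K (leqnn K)) HK] := cvg_infprod u01.
have := @cvgn_prod _ _ (index_enum 'I_K) (fun n i => u_ n i) (fun i => u i) (fun i _ => cu i).
move=> /cvgrPdist_lt/(_ (e / 2) e20); apply: filterS => n Hn.
have l1 := infprod_le K u01; have l2 := infprod_le K (u_01 n).
have l3 := le n.
move: HK Hn; rewrite /= !ltr_norml => /andP[a1 a2] /andP[b1 b2].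
move: a1 a2 b1 b2 l1 l2 l3.
set p := \prod_(_ < _) _; set q := \prod_(_ < _) _.
move=> *; apply/andP; split; lra.
Qed.

End InfiniteProducts.

(** * Point counts and their generating functions *)

Section Counting.
Context {T : Type} {R : realType} (xi : nat -> T -> R).
Implicit Types (C : set R) (w : T).

Definition hits C w (K : nat) : nat := \sum_(i < K) (xi i w \in C).

Lemma hits_nondecreasing C w : {homo hits C w : m n / (m <= n)%N}.
Proof.
move=> m n; elim: n => [|n IH]; first by rewrite leqn0 => /eqP ->.
rewrite leq_eqVlt => /predU1P[-> //|/IH mn].
by rewrite /hits big_ord_recr/= (leq_trans mn)// leq_addr.
Qed.

Lemma nondecreasing_nat_dichotomy (h : nat -> nat) :
  {homo h : m n / (m <= n)%N} ->
  (exists k, \forall K \near \oo, h K = k) \/ (forall k, exists K, (k < h K)%N).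
Proof.
move=> nd; have [[k hk]|nk] := pselect (exists k, forall K, (h K <= k)%N); last first.
  right=> k; apply: contrapT => nK; apply: nk; exists k => K.
  by rewrite leqNgt; apply/negP => kK; apply: nK; exists K.
(* Descent on the bound: either it is attained, and the sequence is constant from then on, or it can
   be lowered. *)
left; elim: k hk => [|k IH] hk.
  by exists 0%N; near=> K; apply/eqP; rewrite -leqn0 hk.
have [[K0 hK0]|nK0] := pselect (exists K, h K = k.+1); last first.
  apply: IH => K; rewrite -ltnS ltn_neqAle hk andbT.
  by apply/eqP => e; apply: nK0; exists K.
exists k.+1; exists K0 => // K /= KK0.
by apply/eqP; rewrite eqn_leq hk/= -hK0 nd.
Unshelve. all: by end_near. Qed.

Lemma hitsE C w K :
  (((hits C w K)%:R : R)%:E = \sum_(0 <= i < K) \d_(xi i w) C)%E.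
Proof.
rewrite big_mkord /hits natr_sum -sumEFin.
by apply: eq_bigr => i _; rewrite diracE.
Qed.

Lemma cvg_count_points C w :
  ((hits C w K)%:R : R)%:E @[K --> \oo] --> count_points xi w C.
Proof. by under eq_fun do rewrite hitsE; exact: is_cvg_nneseries. Qed.

Lemma count_points_ge C w K : (((hits C w K)%:R : R)%:E <= count_points xi w C)%E.
Proof. by rewrite hitsE; exact: nneseries_lim_ge. Qed.

(* 0 if infinitely many points lie in C *)
Definition pow_count C (a : R) w : R := limn (fun K => a ^+ hits C w K).

(** Finitely or infinitely many hits. In the second case a < 1 forces the limit 0, in accordance
    with the sum over finite counts in [pow_count_pair], whose terms then all vanish. *)
Lemma pow_count_cases C (a : R) w : 0 <= a < 1 ->
  (exists k, [/\ count_points xi w C = ((k%:R : R)%:E),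
                 a ^+ hits C w K @[K --> \oo] --> a ^+ k &
                 pow_count C a w = a ^+ k]) \/
  [/\ forall k, count_points xi w C <> ((k%:R : R)%:E),
      a ^+ hits C w K @[K --> \oo] --> 0 & pow_count C a w = 0].
Proof.
move=> /andP[a0 a1].
have [[k hk]|hoo] := nondecreasing_nat_dichotomy (@hits_nondecreasing C w).
  left; exists k.
  have ck : a ^+ hits C w K @[K --> \oo] --> a ^+ k.
    by apply: cvg_near_cst; apply: filterS hk => K ->.
  split => //; last exact: cvg_lim.
  rewrite -(cvg_lim _ (cvg_count_points (C := C) (w := w)))//.
  by apply/cvg_lim => //; apply: cvg_near_cst; apply: filterS hk => K ->.
right; have c0 : a ^+ hits C w K @[K --> \oo] --> 0.
  have na : `|a| < 1 by rewrite ger0_norm.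
  have /cvgrPdist_lt ca := cvg_geometric 1 na.
  apply/cvgrPdist_lt => e /ca[k _ ke].
  have [K0 kK0] := hoo k.
  exists K0 => // K /= KK0.
  have := ke (hits C w K); rewrite /geometric/= mul1r; apply.
  by rewrite (leq_trans (ltnW kK0))// hits_nondecreasing.
split => //; last exact: cvg_lim.
move=> k ck; have [K kK] := hoo k.
by have := count_points_ge C w K; rewrite ck lee_fin ler_nat leqNgt kK.
Qed.

Lemma cvg_pow_count C (a : R) w : 0 <= a < 1 ->
  a ^+ hits C w K @[K --> \oo] --> pow_count C a w.
Proof.
by move=> a01; have [[k [_ ck ->]]|[_ ck ->]] := @pow_count_cases C a w a01.
Qed.

End Counting.

Section PoissonCounts.
Context {R : realType} d (T : measurableType d) (P : probability T R).
Variable xi : nat -> {RV P >-> R}.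

Lemma measurable_count_eq (C : set R) k : measurable C ->
  measurable [set w | count_points xi w C = ((k%:R : R)%:E)].
Proof.
move=> mC.
have mcount : measurable_fun setT (fun w => count_points xi w C).
  apply: (ge0_emeasurable_sum (h := fun i w => \d_(xi i w) C) (P := xpredT)) => //.
  move=> i _; under eq_fun do rewrite diracE.
  apply/measurable_EFinP; have [mI _] := indic_unit_borel mC.
  exact: (measurableT_comp mI (measurable_funP (xi i))).
rewrite -[X in measurable X]setTI.
exact: (mcount measurableT _ (emeasurable_set1 _)).
Qed.

(** The analogue of [offspring_pair] for counts: b is the Poisson(r) probability of the event whose
    indicator is a. *)
Definition count_pair (C : set R) (r : R) (a b : T -> R) := exists k,
  a = (fun w => (count_points xi w C == ((k%:R : R)%:E))%:R) /\
  b = (fun=> expR (- r) / k`!%:R * r ^+ k).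

Lemma count_pair_good C r a b : measurable C -> 0 <= r ->
  count_pair C r a b -> good_pair a b.
Proof.
move=> mC r0 [k [-> ->]]; split => //.
- rewrite (_ : (fun _ => _) = \1_[set w | count_points xi w C = ((k%:R : R)%:E)]).
    by apply: measurable_indic; exact: measurable_count_eq.
  apply/funext => w; rewrite indicE; congr (nat_of_bool _)%:R.
  by apply/eqP/idP; rewrite inE.
- by move=> w; rewrite mulr_ge0 ?divr_ge0 ?expR_ge0 ?exprn_ge0.
Qed.

(** The generating function of the Poisson(r) law, E a^N = exp(- r (1 - a)), expanded over the
    values k of N on both sides. *)
Lemma pow_count_pair C r a : 0 <= a < 1 -> 0 <= r ->
  closure_pair (count_pair C r) (pow_count xi C a) (fun=> expR (- (r * (1 - a)))).
Proof.
move=> a01 r0; have /andP[a0 a1] := a01.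
apply: (cl_lim
  (a_ := fun n w => \sum_(k < n) a ^+ k * (count_points xi w C == ((k%:R : R)%:E))%:R)
  (b_ := fun n w => \sum_(k < n) a ^+ k * (expR (- r) / k`!%:R * r ^+ k))).
- move=> n; apply: (closure_pair_sum
    (a := fun k w => a ^+ k * (count_points xi w C == ((k%:R : R)%:E))%:R)
    (b := fun k w => a ^+ k * (expR (- r) / k`!%:R * r ^+ k))) => k.
  by apply: cl_scale; [exact: exprn_ge0|apply: cl_basic; exists k].
- move=> w; apply: (homo_sum
    (u := fun k => a ^+ k * (count_points xi w C == ((k%:R : R)%:E))%:R)) => k.
  by rewrite mulr_ge0// exprn_ge0.
- move=> w; apply: (homo_sum
    (u := fun k => a ^+ k * (expR (- r) / k`!%:R * r ^+ k))) => k.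
  by rewrite mulr_ge0 ?exprn_ge0// mulr_ge0 ?divr_ge0 ?expR_ge0 ?exprn_ge0.
- move=> w; have [[m [cm _ ->]]|[cm _ ->]] := @pow_count_cases _ _ xi C a w a01.
    have := @cvg_sum_select R (fun k => a ^+ k) m.
    apply: cvg_trans; apply: near_eq_cvg; near=> n.
    apply: eq_bigr => k _; rewrite cm mulrC; congr (_ * _).
    by rewrite eqe eqr_nat.
  under eq_fun => n.
    under eq_bigr => k _.
      have /eqP/negbTE -> := cm k; rewrite mulr0; over.
    rewrite big1//; over.
  exact: cvg_cst.
- move=> w; have := @cvg_exp_sum R (expR (- r)) (r * a).
  rewrite -expRD (_ : - r + r * a = - (r * (1 - a))); last by ring.
  rewrite (_ : (fun n => _) =
    (fun n => \sum_(k < n) a ^+ k * (expR (- r) / k`!%:R * r ^+ k)))//.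
  apply/funext => n; apply: eq_bigr => k _.
  by rewrite exprMn mulrA [LHS]mulrC.
Unshelve. all: by end_near. Qed.

End PoissonCounts.

Section PoissonLaplace.
Context {R : realType} d (T : measurableType d) (P : probability T R).
Variable xi : nat -> {RV P >-> R}.
Hypothesis pp : poisson_process P `[0%R, +oo[ xi.

Lemma poisson_weightE (r : R) k : 0 <= r ->
  poisson_weight r k = (expR (- r) / k`!%:R * r ^+ k)%:E.
Proof.
rewrite le_eqVlt => /predU1P[<-|r0]; rewrite /poisson_weight /poisson_prob.
  rewrite ltxx diracE oppr0 expR0.
  case: k => [|k]; first by rewrite mem_set// fact0 expr0 divr1 mulr1.
  by rewrite memNset// expr0n mulr0.
rewrite r0 esum_set1 ?lee_fin ?poisson_pmf_ge0// /poisson_pmf r0; congr EFin.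
by rewrite mulrC mulrA mulrAC.
Qed.

Lemma poisson_counts (I : eqType) (s : seq I) (C : I -> set R) (k : I -> nat) :
  uniq s -> (forall i, measurable (C i)) ->
  (forall i j, i != j -> C i `&` C j = set0) ->
  (forall i, i \in s -> lebesgue_measure (C i `&` `[0%R, +oo[) < +oo)%E ->
  P [set w | forall i, i \in s -> count_points xi w (C i) = ((k i)%:R%:E)%E] =
  (\prod_(i <- s) (expR (- fine (lebesgue_measure (C i `&` `[0%R, +oo[))) / (k i)`!%:R *
      fine (lebesgue_measure (C i `&` `[0%R, +oo[)) ^+ k i))%:E.
Proof.
(* The head [i0] serves below as the default of [nth], so the empty list is set apart. *)
case: s => [|i0 s'] us mC tC fC.
  rewrite big_nil (_ : [set _ | _] = setT); first exact: probability_setT.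
  by apply/seteqP; split => // w _ i.
set s := i0 :: s' in us *.
have H : (P [set w | forall j : 'I_(size s),
      count_points xi w (C (nth i0 s j)) = (k (nth i0 s j))%:R%:E] =
    \big[*%E/1]_(j < size s) poisson_weight
      (fine (lebesgue_measure (C (nth i0 s j) `&` `[0%R, +oo[))) (k (nth i0 s j)))%E.
  apply: (pp (fun j : 'I_(size s) => k (nth i0 s j))) => //.
    apply/trivIsetP => j j' _ _ jj'; apply: tC.
    by rewrite nth_uniq.
  by move=> j; apply: fC; rewrite mem_nth.
rewrite (_ : [set _ | _] = [set w | forall j : 'I_(size s),
    count_points xi w (C (nth i0 s j)) = (k (nth i0 s j))%:R%:E]); last first.
  apply/seteqP; split => w /= h.
    by move=> j; apply: h; rewrite mem_nth.
  move=> i si; have ii : (index i s < size s)%N by rewrite index_mem.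
  by have := h (Ordinal ii); rewrite /= nth_index.
rewrite H -prodEFin (big_nth i0) big_mkord; apply: eq_bigr => j _.
by rewrite poisson_weightE// fine_ge0.
Qed.

(** Each point in the level set [C b] of phi contributes the factor 1 - b, so the infinite product
    is a finite product of powers whose exponents are the counts in disjoint level sets; these are
    independent Poisson variables. *)
Lemma poisson_laplace_simple c (phi : R -> R) : unit_borel phi ->
  (exists2 s : seq R, uniq s & forall b, b \in s <-> exists z, phi z = b) ->
  (forall z, c <= z -> phi z = 0) ->
  (\int[P]_w (infprod (fun i => 1 - phi (xi i w)))%:E =
   (laplace c (fun z => 1 - phi z) 0)%:E)%E.
Proof.
move=> [mphi phi01] [s0 us0 s0E] phic.
(* The value 0 is dropped: it contributes only factors 1, and its level set contains [c, +oo[, of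
   infinite measure. *)
pose s := [seq b <- s0 | b != 0].
have us : uniq s by rewrite filter_uniq.
pose C b := phi @^-1` [set b].
have mC b : measurable (C b) by rewrite -[C b]setTI; exact: mphi.
have sb b : b \in s -> 0 < b <= 1.
  rewrite mem_filter => /andP[+ /s0E[z zb]]; rewrite -zb => b0.
  by have /andP[p0 ->] := phi01 z; rewrite lt_neqAle p0 eq_sym b0.
have phiE z : phi z = \sum_(b <- s) b * \1_(C b) z.
  rewrite (simple_sumE us0); last by apply/s0E; exists z.
  rewrite big_filter [RHS]big_mkcond/=; apply: eq_bigr => b _.
  by case: eqP => //= ->; rewrite mul0r.
pose r b := fine (lebesgue_measure (C b `&` `[0%R, +oo[)).
(* A positive value is not taken beyond c, so the measures [r b] are those of bounded sets. *)
have CE b : b \in s -> C b `&` `[0%R, +oo[ = C b `&` `[0, c].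
  move=> /sb/andP[b0 _]; apply/seteqP; split => z [Cz]; rewrite /= !in_itv/=.
    rewrite andbT => z0; split => //; rewrite z0/= leNgt.
    apply/negP => /ltW/phic pz; move: Cz; rewrite /C /= pz => b0'.
    by rewrite b0' ltxx in b0.
  by move=> /andP[z0 _]; split => //; rewrite z0.
have rE b : b \in s -> lebesgue_measure (C b `&` `[0%R, +oo[) = (itv_int c \1_(C b) 0)%:E.
  by move=> bs; rewrite CE// itv_int_indic.
have r0 b : 0 <= r b by exact: fine_ge0.
have infE w : infprod (fun i => 1 - phi (xi i w)) =
    \prod_(b <- s) pow_count xi (C b) (1 - b) w.
  apply/cvg_lim => //.
  have -> : (fun K => \prod_(i < K) (1 - phi (xi i w))) =
     (fun K => \prod_(b <- s) (1 - b) ^+ hits xi (C b) w K).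
    apply/funext => K.
    under [RHS]eq_bigr do rewrite /hits -prodrXr.
    rewrite exchange_big/=; apply: eq_bigr => i _.
    have [p0|p0] := eqVneq (phi (xi i w)) 0.
      rewrite p0 subr0 big_seq big1// => b /sb/andP[b0 _].
      rewrite memNset ?expr0// /C/= p0 => b0'; by rewrite b0' ltxx in b0.
    rewrite (bigD1_seq (phi (xi i w)))//=; last first.
      by rewrite mem_filter p0; apply/s0E; exists (xi i w).
    rewrite mem_set ?expr1// big1 ?mulr1// => b bp.
    rewrite memNset ?expr0// /C/= => e.
    by rewrite e eqxx in bp.
  apply: cvgn_prod => b bs; apply: cvg_pow_count.
  by have /andP[b0 b1] := sb b bs; rewrite subr_ge0 b1/= ltrBlDr ltrDl.
under eq_integral do rewrite infE.
pose B b := count_pair xi (C b) (r b).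
have -> : (\int[P]_w (\prod_(b <- s) pow_count xi (C b) (1 - b) w)%:E =
    \int[P]_w (\prod_(b <- s) (expR (- (r b * (1 - (1 - b))))))%:E)%E.
  apply: (closure_pair_prod (B := B)
    (a := fun b w => pow_count xi (C b) (1 - b) w)
    (b := fun b w => expR (- (r b * (1 - (1 - b)))))) => //.
  - by move=> b a1 a2; exact: count_pair_good.
  - move=> a1 a2 a12.
    have /choice[k kE] : forall b, exists k, b \in s ->
        a1 b = (fun w => (count_points xi w (C b) == ((k%:R : R)%:E))%:R) /\
        a2 b = (fun=> expR (- r b) / k`!%:R * r b ^+ k).
      move=> b; have [/a12[k kE]|_] := boolP (b \in s); first by exists k.
      by exists 0%N.
    transitivity (\int[P]_w (\1_[set w | forall b, b \in s ->
        count_points xi w (C b) = ((k b)%:R%:E)%E] w)%:E)%E.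
      apply: eq_integral => w _; congr EFin; rewrite indicE.
      have [wk|wk] := boolP (w \in _).
        rewrite big_seq big1// => b bs; have [-> _] := kE b bs.
        by move/set_mem : wk => /(_ b bs) ->; rewrite eqxx.
      have /existsNP[b /not_implyP[bs nb]] :
          ~ (forall b, b \in s -> count_points xi w (C b) = ((k b)%:R%:E)%E).
        by move=> h; move: wk; rewrite mem_set.
      apply/eqP; rewrite prodf_seq_eq0; apply/hasP; exists b => //=.
      by have [-> _] := kE b bs; move/eqP/negbTE : nb => ->.
    rewrite integral_indic//; last first.
      rewrite (_ : [set _ | _] = \bigcap_(b in [set` s])
          [set w | count_points xi w (C b) = ((k b)%:R%:E)%E]); last first.
        by apply/seteqP; split => w h b /h.
      apply: fin_bigcap_measurable => // b _; exact: measurable_count_eq.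
    rewrite setIT; apply: (etrans (@poisson_counts _ s C k us mC _ _)).
    + move=> b b' bb'; apply/seteqP; split => // z [zb zb'].
      by move: bb'; rewrite -zb -zb' eqxx.
    + by move=> b bs; rewrite rE// ltry.
    + rewrite [RHS](_ : _ = (\int[P]_w (\prod_(b <- s)
          (expR (- r b) / (k b)`!%:R * r b ^+ k b))%:E)%E).
        by rewrite integral_cst// -[LHS]mule1; congr (_ * _)%E; apply/esym; exact: probability_setT.
      apply: eq_integral => w _; congr EFin; rewrite big_seq [RHS]big_seq.
      by apply: eq_bigr => b bs; have [_ ->] := kE b bs.
  - move=> b bs; apply: pow_count_pair => //.
    by have /andP[b0 b1] := sb b bs; rewrite subr_ge0 b1/= ltrBlDr ltrDl.
rewrite integral_cst// -[RHS]mule1; congr (_ * _)%E; last exact: probability_setT.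
rewrite -expR_sum; congr (expR _)%:E.
under [in RHS]eq_fun do rewrite subKr.
have -> : phi = (fun z => \sum_(b <- s) b * \1_(C b) z) by exact/funext.
rewrite (itv_int_simple _ _ _ mC).2; last by move=> b /sb/andP[/ltW].
rewrite -sumrN big_seq [RHS]big_seq; apply: eq_bigr => b bs.
by rewrite subKr mulrC /r rE.
Qed.

End PoissonLaplace.

Section PoissonLaplaceGeneral.
Context {R : realType} d (T : measurableType d) (P : probability T R).
Variable xi : nat -> {RV P >-> R}.

Lemma measurable_infprod (f : R -> R) : unit_borel f ->
  measurable_fun setT (fun w => infprod (fun i => f (xi i w))).
Proof.
move=> [mf f01].
apply: (measurable_fun_cvgn (f_ := fun K w => \prod_(i < K) f (xi i w))).
  move=> K; apply: (measurable_prod (h := fun (i : 'I_K) w => f (xi i w))) => i _.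
  exact: (measurableT_comp mf (measurable_funP (xi i))).
by move=> w; apply: cvg_infprod => i; exact: f01.
Qed.

(** It is 1 - f that is approximated from below: the simple functions then vanish beyond c as 1 - f
    does, and the infinite products converge to the one for f, dominated by 1. *)
Lemma poisson_laplace (c : R) (f : R -> R) : poisson_process P `[0, +oo[ xi ->
  unit_borel f -> (forall z, c <= z -> f z = 1) ->
  (\int[P]_w (infprod (fun i => f (xi i w)))%:E = (laplace c f 0)%:E)%E.
Proof.
move=> pp uf fc; have [mf f01] := uf.
have [s_ [sim us le nd cv]] := simple_unit_approx (unit_borelN uf).
have uN n := unit_borelN (us n).
have H1 : (\int[P]_w (infprod (fun i => 1 - s_ n (xi i w)))%:E)%E @[n --> \oo]
    --> (\int[P]_w (infprod (fun i => f (xi i w)))%:E)%E.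
  apply: (@dominated_cvg _ _ _ _ _ _ _ _ (fun=> 1%E)) => //.
  - by move=> n; apply/measurable_EFinP; exact: measurable_infprod (uN n).
  - move=> w _; apply/fine_cvgP; split; first exact: nearW.
    apply: cvg_infprod_nonincreasing => //.
    + by move=> n i; have [_] := uN n; exact.
    + by move=> n i; rewrite -(subKr 1 (f (xi i w))) lerB// le.
    + move=> i; rewrite -[X in _ --> X](subKr 1); apply: cvgB; first exact: cvg_cst.
      exact: cv.
  - exact: finite_measure_integrable_cst.
  - move=> n w _; rewrite lee_fin ger0_norm.
    + by have /andP[] := infprod01 (fun i => (uN n).2 (xi i w)).
    + by have /andP[] := infprod01 (fun i => (uN n).2 (xi i w)).
have H2 : (\int[P]_w (infprod (fun i => 1 - s_ n (xi i w)))%:E)%E @[n --> \oo]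
    --> (laplace c f 0)%:E.
  under eq_fun => n.
    rewrite (poisson_laplace_simple (c := c) pp (us n) (sim n)); last first.
      move=> z /fc fz; apply/le_anti/andP; split.
        by have := le n z; rewrite fz subrr.
      by have [_ /(_ z)/andP[]] := us n.
    over.
  apply/fine_cvgP; split; first exact: nearW.
  apply: (@cvg_comp _ _ _ (fun n => - itv_int c (fun z => 1 - (1 - s_ n z)) 0) expR
    _ _ _ _ (@continuous_expR R _)); apply: cvgN.
  apply: cvg_itv_int.
  - by move=> n; exact/unit_bounded_borel/unit_borelN.
  - exact/unit_bounded_borel/unit_borelN.
  - by move=> z m n mn; rewrite !subKr nd.
  - move=> z; under eq_fun do rewrite subKr; exact: cv.
by rewrite -(cvg_lim _ H1)// -(cvg_lim _ H2).
Qed.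

End PoissonLaplaceGeneral.

(** * Translation invariance *)

Section LaplaceShift.
Context {R : realType}.
Implicit Types (x y : R) (f g : R -> R).

Lemma lebesgue_measure_shift y (A : set R) : measurable A ->
  lebesgue_measure ((fun z : R => y + z) @^-1` A) = lebesgue_measure A.
Proof.
move=> mA.
have mshift : measurable_fun setT (fun z : measurableTypeR R => (y + z : measurableTypeR R)).
  by apply: measurable_funD.
pose sh : {mfun measurableTypeR R >-> measurableTypeR R} :=
  HB.pack (fun z : measurableTypeR R => (y + z : measurableTypeR R))
    (isMeasurableFun.Build _ _ _ _ _ mshift).
apply/esym; apply: (@lebesgue_measure_unique R (pushforward lebesgue_measure sh)) => //.
move=> _ [[a b] _ <-].
change (lebesgue_measure `]a, b]%classic = lebesgue_measure (sh @^-1` `]a, b]%classic)).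
rewrite (_ : sh @^-1` _ = `]a - y, b - y]%classic); last first.
  by apply/seteqP; split => z; rewrite /= !in_itv/= ltrBlDl lerBrDl addrC.
rewrite !lebesgue_measure_itv/= !lte_fin ltrD2r -!EFinB.
by rewrite opprB addrA subrK.
Qed.

Lemma itv_int_shift f x y : bounded_borel f ->
  itv_int (x - y) (fun z => f (y + z)) 0 = itv_int x f y.
Proof.
move=> bf; have [mf [M fM]] := bf.
have mshift : measurable_fun setT (fun z : measurableTypeR R => (y + z : measurableTypeR R)).
  by apply: measurable_funD.
pose sh : {mfun measurableTypeR R >-> measurableTypeR R} :=
  HB.pack (fun z : measurableTypeR R => (y + z : measurableTypeR R))
    (isMeasurableFun.Build _ _ _ _ _ mshift).
apply: EFin_inj; rewrite -!itv_intE//; last first.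
  by split; [exact: (measurableT_comp mf)|exists M => z; exact: fM].
rewrite (_ : `[0, x - y]%classic = sh @^-1` `[y, x]%classic); last first.
  by apply/seteqP; split => z; rewrite /= !in_itv/= lerBrDl lerDl.
rewrite -[LHS](ge0_integral_pushforward (phi := sh) mshift lebesgue_measure
  (D := `[y, x]%classic) (f := EFin \o f))//.
- apply: eq_measure_integral => A mA _; exact: lebesgue_measure_shift.
- by apply/measurable_EFinP/measurable_funTS.
- by move=> z _; rewrite lee_fin; have /andP[] := fM z.
Qed.

(** A particle at y reproduces through displacements on [0, +oo[, so its Laplace functional first
    appears at the origin, with cutoff x - y. *)
Lemma laplace_shift x y g : unit_borel g ->
  laplace (x - y) (fun z => g (y + z)) 0 = laplace x g y.
Proof.
move=> ug; rewrite /laplace -(itv_int_shift (f := fun z => 1 - g z))//.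
exact/unit_bounded_borel/unit_borelN.
Qed.

End LaplaceShift.

(** * Independence of sigma-algebras generated by disjoint families *)

Section Independence.
Context {R : realType} d (T : measurableType d) (P : probability T R).

(** As functions of E, both sides are finite measures that agree on the pi-system G, hence on the
    sigma-algebra it generates. *)
Lemma indep_g_sigma_algebra_l (G : set (set T)) (F : set T) :
  G `<=` measurable -> setI_closed G -> G setT -> measurable F ->
  (forall E, G E -> P (E `&` F) = (P E * P F)%E) ->
  forall E, <<s G >> E -> P (E `&` F) = (P E * P F)%E.
Proof.
move=> Gm GI GT mF GF E GE.
have PF : P F = (fine (P F))%:E by rewrite fineK// fin_num_measure.
have PF0 : 0 <= fine (P F) by exact: fine_ge0.
rewrite muleC PF.
have := @g_sigma_algebra_measure_unique _ R T G Gm (fun=> setT) (fun=> GT) _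
  (mrestr P mF) (mscale (NngNum PF0) P) GI _ _ E GE.
apply.
- by rewrite bigcup_const.
- move=> A GA; apply: (etrans (GF A GA)); rewrite muleC.
  by rewrite {1}PF.
- by move=> _; change (P (setT `&` F) < +oo)%E; rewrite setTI PF ltry.
Qed.

Lemma indep_g_sigma_algebra (G H : set (set T)) :
  G `<=` measurable -> H `<=` measurable -> setI_closed G -> setI_closed H ->
  G setT -> H setT ->
  (forall E F, G E -> H F -> P (E `&` F) = (P E * P F)%E) ->
  forall E F, <<s G >> E -> <<s H >> F -> P (E `&` F) = (P E * P F)%E.
Proof.
move=> Gm Hm GI HI GT HT GH E F GE HF.
have sGm : <<s G >> `<=` measurable.
  by apply: smallest_sub => //; exact: sigma_algebra_measurable.
rewrite setIC muleC.
apply: (indep_g_sigma_algebra_l Hm HI HT (sGm _ GE) _ HF) => F' HF'.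
rewrite setIC muleC.
apply: (indep_g_sigma_algebra_l Gm GI GT (Hm _ HF') _ GE) => E' GE'.
exact: GH.
Qed.

Variables (I : eqType) (S : I -> set (set T)).
Hypothesis indS : mutually_independent P S.
Hypothesis Sm : forall i, S i `<=` measurable.
Hypothesis ST : forall i, S i setT.
Hypothesis SI : forall i, setI_closed (S i).

Definition family_sigma (A : set I) : set (set T) := <<s \bigcup_(i in A) S i >>.

(** A pi-system of finite intersections generating [family_sigma A], on which mutual independence
    can be applied directly. *)
Let cylinders (A : set I) : set (set T) := [set E | exists s (F : I -> set T),
  [/\ uniq s, forall i, i \in s -> A i /\ S i (F i) &
      E = [set w | forall i, i \in s -> F i w] ] ].

Let cylinders_measurable A : cylinders A `<=` measurable.
Proof.
move=> _ [s [F [us sF ->]]].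
rewrite (_ : [set _ | _] = \bigcap_(i in [set` s]) F i).
  apply: fin_bigcap_measurable => // i /= /sF[_]; exact: Sm.
by apply/seteqP; split => w h i /h.
Qed.

Let cylindersT A : cylinders A setT.
Proof.
exists [::], (fun=> setT); split => //.
by apply/seteqP; split.
Qed.

Let cylindersI A : setI_closed (cylinders A).
Proof.
move=> _ _ [s1 [F1 [us1 sF1 ->]]] [s2 [F2 [us2 sF2 ->]]].
(* An index missing from one of the lists is given the whole space there. *)
pose F i := (if i \in s1 then F1 i else setT) `&` (if i \in s2 then F2 i else setT).
exists (undup (s1 ++ s2)), F; split; first exact: undup_uniq.
- move=> i; rewrite mem_undup mem_cat => i12; split.
    by move: i12 => /orP[/sF1[]|/sF2[]].
  apply: SI.
    by case: ifPn => // /sF1[].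
  by case: ifPn => // /sF2[].
- apply/seteqP; split => w /=.
    move=> [h1 h2] i _; split; first by case: ifPn => // /h1.
    by case: ifPn => // /h2.
  move=> h; split => i si.
    by have [] := h i _; rewrite ?mem_undup ?mem_cat ?si.
  by have [] := h i _; rewrite ?mem_undup ?mem_cat ?si ?orbT.
Qed.

Lemma family_sigma_cylinders A : family_sigma A `<=` <<s cylinders A >>.
Proof.
apply: smallest_sub; first exact: smallest_sigma_algebra.
move=> E [i Ai SE]; apply: sub_sigma_algebra.
exists [:: i], (fun=> E); split => //.
  by move=> j; rewrite inE => /eqP ->.
apply/seteqP; split => w /=; first by move=> ? ?.
by move=> /(_ i); rewrite mem_head; apply.
Qed.

(** For cylinders, disjoint A and B make [s1 ++ s2] duplicate-free; mutual independence along it,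
    along [s1] and along [s2] gives the product rule. *)
Lemma indep_family_sigma A B E F : A `&` B = set0 ->
  family_sigma A E -> family_sigma B F -> P (E `&` F) = (P E * P F)%E.
Proof.
move=> AB /family_sigma_cylinders AE /family_sigma_cylinders BF.
apply: (indep_g_sigma_algebra _ _ _ _ _ _ _ AE BF) => //.
move=> _ _ [s1 [F1 [us1 sF1 ->]]] [s2 [F2 [us2 sF2 ->]]].
pose H i := if i \in s1 then F1 i else F2 i.
have s12 i : i \in s2 -> i \in s1 = false.
  move=> /sF2[Bi _]; apply/negP => /sF1[Ai _].
  by have : (A `&` B) i by []; rewrite AB.
have us : uniq (s1 ++ s2).
  by rewrite cat_uniq us1 us2 andbT/=; apply/hasPn => i /s12 ->.
have e1 : [set w | forall i, i \in s1 -> F1 i w] = [set w | forall i, i \in s1 -> H i w].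
  by apply/seteqP; split => w h i si; have := h i si; rewrite /H si.
have e2 : [set w | forall i, i \in s2 -> F2 i w] = [set w | forall i, i \in s2 -> H i w].
  by apply/seteqP; split => w h i si; have := h i si; rewrite /H s12.
have SH i : i \in s1 ++ s2 -> S i (H i).
  rewrite mem_cat /H; case: ifPn => [/sF1[]//|_ /= /sF2[]//].
rewrite e1 e2.
rewrite (indS us1); last by move=> i si; apply: SH; rewrite mem_cat si.
rewrite (indS us2); last by move=> i si; apply: SH; rewrite mem_cat si orbT.
rewrite -big_cat -(indS us SH); congr (P _).
apply/seteqP; split => w /=.
  by move=> [h1 h2] i; rewrite mem_cat => /orP[/h1|/h2].
by move=> h; split => i si; apply: h; rewrite mem_cat si ?orbT.
Qed.

Lemma family_sigma_measurable A : family_sigma A `<=` measurable.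
Proof.
apply: smallest_sub; first exact: sigma_algebra_measurable.
by move=> E [i _]; exact: Sm.
Qed.

Lemma sub_family_sigma A i : A i -> S i `<=` family_sigma A.
Proof. by move=> Ai E SE; apply: sub_sigma_algebra; exists i. Qed.

End Independence.

(** * The branching Poisson process *)

Section IndependentSections.
Context {R : realType} d (T : measurableType d) (P : probability T R).
Variables G H : set (set T).
Hypothesis Gm : G `<=` measurable.
Hypothesis Hm : H `<=` measurable.
Hypothesis GH : forall E F, <<s G >> E -> <<s H >> F -> P (E `&` F) = (P E * P F)%E.

Let measurable_id_g (K : set (set T)) : K `<=` measurable ->
  measurable_fun setT (fun w : T => w : g_sigma_algebraType K).
Proof.
move=> Km _ A mA; rewrite setTI.
have : <<s K >> `<=` (@measurable d T).
  by apply: smallest_sub => //; exact: sigma_algebra_measurable.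
by move=> /(_ _ mA).
Qed.

(* Independence says that w |-> (w, w) maps P to the product of its restrictions
   to the two sigma-algebras; then Fubini applies. *)
Lemma indep_sections (E : set (g_sigma_algebraType G * g_sigma_algebraType H)) :
  measurable E ->
  (P [set w | E (w, w)] = \int[P]_w P [set w2 | E (w, w2)])%E.
Proof.
move=> mE.
pose X1 : {mfun T >-> g_sigma_algebraType G} :=
  HB.pack (fun w : T => w : g_sigma_algebraType G)
    (isMeasurableFun.Build _ _ _ _ _ (measurable_id_g Gm)).
pose X2 : {mfun T >-> g_sigma_algebraType H} :=
  HB.pack (fun w : T => w : g_sigma_algebraType H)
    (isMeasurableFun.Build _ _ _ _ _ (measurable_id_g Hm)).
have mdiag : measurable_fun setT (fun w : T =>
    (w : g_sigma_algebraType G, w : g_sigma_algebraType H)).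
  by apply: measurable_fun_pair; exact: measurable_id_g.
pose X12 : {mfun T >-> (g_sigma_algebraType G * g_sigma_algebraType H)%type} :=
  HB.pack (fun w : T => (w : g_sigma_algebraType G, w : g_sigma_algebraType H))
    (isMeasurableFun.Build _ _ _ _ _ mdiag).
have -> : P [set w | E (w, w)] = pushforward P X12 E by [].
rewrite -(@product_measure_unique _ _ _ _ _ (distribution P X1) (distribution P X2)
  (pushforward P X12) _ E mE); last first.
  by move=> A B mA mB; exact: GH.
rewrite /product_measure1 /= /distribution.
rewrite (ge0_integral_pushforward (phi := X1)) ?preimage_setT//.
- apply: eq_integral => w _ /=; rewrite /pushforward/=; congr (P _).
  by apply/seteqP; split => w2 /=; rewrite xsectionP.
- exact: (measurable_fun_xsection (distribution P X2) mE).
- by move=> w _; exact: measure_ge0.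
Qed.

End IndependentSections.

(** * Recursion over the generations *)

Section BranchingRecursion.
Context {R : realType} d (T : measurableType d) (P : probability T R).
Variable xi : label -> nat -> {RV P >-> R}.
Hypothesis bp : branching_poisson P xi.
Variable x : R.

Local Notation S v := (sigma_of_sequence (xi v)).

Lemma sigma_of_sequence_measurable v : S v `<=` measurable.
Proof.
apply: smallest_sub; first exact: sigma_algebra_measurable.
move=> _ [i [B [mB ->]]]; rewrite -[X in measurable X]setTI.
exact: measurable_funP.
Qed.

Lemma sigma_of_sequenceT v : S v setT.
Proof.
have [h0 hD _] := smallest_sigma_algebra setT
  [set E | exists i B, measurable B /\ E = (xi v i : T -> R) @^-1` B].
by rewrite -(setD0 setT); exact: hD.
Qed.

Lemma sigma_of_sequenceI v : setI_closed (S v).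
Proof.
pose gT := g_sigma_algebraType
  [set E | exists i B, measurable B /\ E = (xi v i : T -> R) @^-1` B].
by move=> A B SA SB; exact: (@measurableI _ gT).
Qed.

Local Notation FS A := (family_sigma (fun v => S v) A).
Local Notation indFS := (indep_family_sigma (branching_independence bp)
  sigma_of_sequence_measurable sigma_of_sequenceT sigma_of_sequenceI).

(* position of r ++ v relative to that of r *)
Definition relpos (r v : label) (w : T) : R :=
  \sum_(i < size v) xi (r ++ take i v) (nth 0%N v i) w.

Lemma relpos_cons r i v w :
  relpos r (i :: v) w = xi r i w + relpos (rcons r i) v w.
Proof.
rewrite /relpos big_ord_recl/= cats0; congr (_ + _).
by apply: eq_bigr => j _; rewrite cat_rcons.
Qed.

(** y is a deterministic stand-in for the position of r, so the event depends only on displacements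
    within the subtree of r. *)
Definition all_beyond (m : nat) (r : label) (y : R) : set T :=
  [set w | forall v, size v = m -> x <= y + relpos r v w].

Definition descendants (r : label) : set label := [set v | prefix r v].

Lemma measurable_xi (A : set label) v i : A v -> measurable_fun setT
  (xi v i : g_sigma_algebraType (\bigcup_(v in A) S v) -> R).
Proof.
move=> Av _ B mB; rewrite setTI; apply: (sub_family_sigma (S := fun v => S v) Av).
by apply: sub_sigma_algebra; exists i, B.
Qed.

Lemma measurable_relpos (A : set label) r v : descendants r `<=` A ->
  measurable_fun setT
  (relpos r v : g_sigma_algebraType (\bigcup_(v in A) S v) -> R).
Proof.
move=> rA; apply: measurable_sum => i; apply: measurable_xi; apply: rA.
exact: prefix_prefix.
Qed.

Lemma all_beyond_sigma (A : set label) m r y : descendants r `<=` A ->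
  FS A (all_beyond m r y).
Proof.
move=> rA; pose gT := g_sigma_algebraType (\bigcup_(v in A) S v).
(* Membership in [family_sigma A] is measurability in [gT]; labels being countable, the event is a
   countable intersection. *)
have : measurable (all_beyond m r y : set gT); last by [].
rewrite (_ : all_beyond m r y =
    \bigcap_(v : label) [set w | size v = m -> x <= y + relpos r v w]); last first.
  by apply/seteqP; split => [w h v _|w h v]; [exact: (h v)|exact: (h v I)].
apply: countable_bigcapT_measurable => v.
have [vm|vm] := eqVneq (size v) m; last first.
  rewrite (_ : [set _ | _] = setT)//; apply/seteqP; split => // w _ /= e.
  by rewrite e eqxx in vm.
rewrite (_ : [set _ | _] = setT `&` (relpos r v : gT -> R) @^-1` `[x - y, +oo[).
  by apply: measurable_relpos.
by apply/seteqP; split => w /=; rewrite in_itv/= andbT lerBlDl; [split => //; auto|case].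
Qed.

Lemma all_beyond_measurable m r y : measurable (all_beyond m r y).
Proof.
apply: (family_sigma_measurable sigma_of_sequence_measurable (A := setT)).
exact: all_beyond_sigma.
Qed.

(** Used to see that the subtrees of distinct siblings have disjoint label sets. *)
Lemma prefix_rcons_inj r (i j : nat) v :
  prefix (rcons r i) v -> prefix (rcons r j) v -> i = j.
Proof.
move=> /prefixP[s1 ->] /prefixP[s2].
by rewrite !cat_rcons => /eqP; rewrite eqseq_cat// => /andP[_ /eqP[]].
Qed.

Lemma siblings_beyond_indep m r (u : nat -> R) K :
  P [set w | forall i, (i < K)%N -> all_beyond m (rcons r i) (u i) w] =
  (\prod_(i < K) P (all_beyond m (rcons r i) (u i)))%E.
Proof.
elim: K => [|K IH].
  rewrite big_ord0 (_ : [set _ | _] = setT); first exact: probability_setT.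
  by apply/seteqP; split.
rewrite big_ord_recr/= -IH.
(* Labels in the subtrees of the first K siblings, disjoint from the subtree of sibling K. *)
pose A := [set v | exists2 i, (i < K)%N & prefix (rcons r i) v].
rewrite -(indFS (A := A) (B := descendants (rcons r K))).
- congr (P _); apply/seteqP; split => w /=.
    by move=> h; split; [move=> i iK; apply: h; exact: ltnW|exact: h].
  move=> [h1 h2] i; rewrite ltnS leq_eqVlt => /predU1P[->//|]; exact: h1.
- apply/seteqP; split => // v [[i iK iv] Kv].
  by rewrite (prefix_rcons_inj iv Kv) ltnn in iK.
- pose gT := g_sigma_algebraType (\bigcup_(v in A) S v).
  have : measurable ([set w | forall i, (i < K)%N -> all_beyond m (rcons r i) (u i) w]
      : set gT); last by [].
  rewrite (_ : [set _ | _] = \bigcap_(i in [set i | (i < K)%N])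
    all_beyond m (rcons r i) (u i)); last by [].
  apply: bigcap_measurableType => // i iK.
  by apply: all_beyond_sigma => v vi; exists i.
- exact: all_beyond_sigma.
Qed.

(** Continuity from above, along the events for the first K siblings. *)
Lemma siblings_beyond m r (u : nat -> R) (q : nat -> R) :
  (forall i, 0 <= q i <= 1) ->
  (forall i, P (all_beyond m (rcons r i) (u i)) = (q i)%:E) ->
  P [set w | forall i, all_beyond m (rcons r i) (u i) w] = (infprod q)%:E.
Proof.
move=> q01 Pq.
pose F K := [set w | forall i, (i < K)%N -> all_beyond m (rcons r i) (u i) w].
have mF K : measurable (F K).
  rewrite (_ : F K = \bigcap_(i in [set i | (i < K)%N]) all_beyond m (rcons r i) (u i))//.
  by apply: bigcap_measurableType => // i _; exact: all_beyond_measurable.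
have FE : [set w | forall i, all_beyond m (rcons r i) (u i) w] = \bigcap_K F K.
  apply/seteqP; split => w /=; first by move=> h K _ i _; exact: h.
  by move=> h i; exact: (h i.+1 I i (ltnSn i)).
have H1 : P (F K) @[K --> \oo] --> P (\bigcap_K F K).
  apply: nonincreasing_cvg_mu => //.
  - by rewrite ltey_eq fin_num_measure.
  - exact: bigcapT_measurable.
  - move=> m1 m2 m12; apply/subsetPset => w h i im.
    by apply: h; exact: (leq_trans im).
have H2 : P (F K) @[K --> \oo] --> (infprod q)%:E.
  have -> : (fun K => P (F K)) = (fun K => (\prod_(i < K) q i)%:E).
    apply/funext => K; rewrite -prodEFin; apply: (etrans (siblings_beyond_indep _ _ _ _)).
    by apply: eq_bigr => i _.
  apply/fine_cvgP; split; first exact: nearW.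
  exact: cvg_infprod.
by rewrite FE -(cvg_lim _ H1)// -(cvg_lim _ H2).
Qed.

Definition beyond0 (z : R) : R := (x <= z)%R%:R.

Lemma unit_borel_beyond0 : unit_borel beyond0.
Proof.
split; last by move=> z; rewrite /beyond0; case: (x <= z); rewrite lexx ler01.
apply: nondecreasing_measurable => // y z yz; rewrite /beyond0 ler_nat.
by have [xy|] := boolP (x <= y); rewrite ?(le_trans xy yz).
Qed.

Lemma unit_borel_iter m : unit_borel (iter m (laplace x) beyond0).
Proof.
by elim: m => [|m IH]; [exact: unit_borel_beyond0|exact: unit_borel_laplace].
Qed.

(** Provides the cutoff hypothesis of [poisson_laplace]: for z >= x the interval [z, x] is null. *)
Lemma iter_laplace_beyond m z : x <= z -> iter m (laplace x) beyond0 z = 1.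
Proof.
move=> xz; case: m => [|m] /=; first by rewrite /beyond0 xz.
rewrite /laplace (_ : itv_int _ _ _ = 0) ?oppr0 ?expR0//.
have ub := unit_borelN (unit_borel_iter m).
apply/le_anti/andP; split.
  apply: (@le_trans _ _ (itv_len x z)); last by rewrite itv_lenE max_l// subr_le0.
  apply: le_itv_int; [exact: unit_bounded_borel|exact: bounded_borel1|].
  by move=> t; have [_ /(_ t)/andP[]] := ub.
by apply: itv_int_ge0 => t; have [_ /(_ t)/andP[]] := ub.
Qed.

(** Both r and y vary in the induction, since the hypothesis is used at each child [rcons r i] with
    position [y + xi r i w]; the value does not depend on r. *)
Lemma all_beyondE m r y :
  P (all_beyond m r y) = (iter m (laplace x) beyond0 y)%:E.
Proof.
elim: m r y => [|m IH] r y.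
  rewrite /= /beyond0; have rel0 w : relpos r [::] w = 0 by rewrite /relpos big_ord0.
  have [xy|xy] := boolP (x <= y).
    rewrite (_ : all_beyond _ _ _ = setT); first exact: probability_setT.
    by apply/seteqP; split => // w _ v /size0nil ->; rewrite rel0 addr0.
  rewrite (_ : all_beyond _ _ _ = set0) ?measure0//; apply/seteqP; split => // w.
  by move=> /(_ [::] erefl); rewrite rel0 addr0 (negbTE xy).
(* [A] carries the displacements of the children of r, [B] everything inside their subtrees. [E]
   reads the former from the first coordinate and the latter from the second, so that a section
   freezes the positions of the children. *)
pose A : set label := [set r].
pose B : set label := [set v | exists i, prefix (rcons r i) v].
pose gA := g_sigma_algebraType (\bigcup_(v in A) S v).
pose gB := g_sigma_algebraType (\bigcup_(v in B) S v).
pose E : set (gA * gB) := [set w | forall i v, size v = m ->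
  x <= y + xi r i w.1 + relpos (rcons r i) v w.2].
have mE : measurable E.
  rewrite (_ : E = \bigcap_(i : nat) \bigcap_(v : label)
     [set w | size v = m -> x <= y + xi r i w.1 + relpos (rcons r i) v w.2]); last first.
    by apply/seteqP; split => [w h i _ v _|w h i v]; [exact: h|exact: (h i I v I)].
  apply: bigcap_measurableType => // i _.
  apply: countable_bigcapT_measurable => v.
  have [vm|vm] := eqVneq (size v) m; last first.
    rewrite (_ : [set _ | _] = setT)//; apply/seteqP; split => // w _ /= e.
    by rewrite e eqxx in vm.
  have mf : measurable_fun setT (fun w : gA * gB =>
      y + (xi r i : gA -> R) w.1 + (relpos (rcons r i) v : gB -> R) w.2).
    apply: measurable_funD.
      apply: measurable_funD => //.
      apply: (@measurableT_comp _ _ _ _ _ _ (xi r i : gA -> R)); last exact: measurable_fst.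
      exact: measurable_xi.
    apply: (@measurableT_comp _ _ _ _ _ _ (relpos (rcons r i) v : gB -> R));
      last exact: measurable_snd.
    by apply: measurable_relpos => u ru; exists i.
  rewrite (_ : [set _ | _] = setT `&` (fun w : gA * gB =>
      y + (xi r i : gA -> R) w.1 + (relpos (rcons r i) v : gB -> R) w.2) @^-1` `[x, +oo[).
    exact: mf.
  by apply/seteqP; split => w /=; rewrite in_itv/= andbT; [split => //; auto|case].
have ab : A `&` B = set0.
  apply/seteqP; split => // _ [-> [i /prefixP[s e]]].
  have := congr1 size e; rewrite size_cat size_rcons => /eqP.
  by rewrite addSn -addnS -{1}[size r]addn0 eqn_add2l.
have -> : all_beyond m.+1 r y = [set w | E (w, w)].
  apply/seteqP; split => w /=.
    move=> h i v vm; have := h (i :: v); rewrite /= vm relpos_cons addrA; exact.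
  by move=> h [//|i v] [vm]; rewrite relpos_cons addrA; exact: h.
rewrite (@indep_sections _ _ _ P _ _ _ _ _ E mE); last first.
- by move=> E1 E2 h1 h2; exact: (indFS ab).
- by move=> C [v _]; exact: sigma_of_sequence_measurable.
- by move=> C [v _]; exact: sigma_of_sequence_measurable.
have [mg g01] := unit_borel_iter m.
rewrite /= -(laplace_shift x y (unit_borel_iter m)).
rewrite -(poisson_laplace (xi := xi r) (P := P)).
(* For fixed w the children sit at [y + xi r i w], and the section has as probability an infinite
   product over them. *)
- apply: eq_integral => w _.
  apply: (siblings_beyond (u := fun i => y + xi r i w)
    (q := fun i => iter m (laplace x) beyond0 (y + xi r i w))) => i.
    exact: g01.
  exact: IH.
- exact: branching_reproduction.
- split; last by move=> z; exact: g01.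
  by apply: (measurableT_comp mg); exact: measurable_funD.
- by move=> z; rewrite lerBlDl => /iter_laplace_beyond.
Qed.

(** On [y, x] the two functions differ only at z = x, which Lebesgue measure ignores. *)
Lemma laplace_beyond0 : laplace x beyond0 = laplace x (fun=> 0).
Proof.
apply/funext => y; congr (expR (- _)); rewrite /itv_int.
have ub := unit_bounded_borel (unit_borelN unit_borel_beyond0).
have u0 : unit_borel (fun _ : R => 0 : R) by split => // z; rewrite lexx ler01.
have ub0 := unit_bounded_borel (unit_borelN u0).
have sub (h : R -> R) : bounded_borel h ->
    lebesgue_measure.-integrable `[y, x[ (EFin \o h).
  move=> bh; apply: integrableS (bounded_borel_integrable x y bh) => //.
  by move=> z; rewrite /= !in_itv/= => /andP[-> /ltW].
rewrite -!Rintegral_itv_bndo_bndc; [|exact: sub ub0|exact: sub ub].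
apply: eq_Rintegral => z; rewrite inE/= in_itv/= => /andP[_ zx].
by rewrite /beyond0 leNgt zx.
Qed.

Lemma leftmost_ge n : P [set w | (x%:E <= leftmost xi n.+1 w)%E] =
  (iter n.+1 (laplace x) (fun=> 0) 0)%:E.
Proof.
rewrite (_ : [set _ | _] = all_beyond n.+1 [::] 0).
  (* The innermost application of [laplace] cannot tell [beyond0] from 0, and the n outer ones are
     the same. *)
  by rewrite all_beyondE !iterSr laplace_beyond0.
apply/seteqP; split => w /= h.
  move=> v vn; rewrite add0r -lee_fin; apply: (le_trans h).
  by apply: ereal_inf_lbound; exists v.
apply: le_ereal_inf_tmp => _ [v /= vn <-]; rewrite lee_fin.
by have := h v vn; rewrite add0r.
Qed.

End BranchingRecursion.

Theorem mainTheorem2 (R : realType) (x : R) (n : nat)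
    (d : measure_display) (T : measurableType d) (P : probability T R)
    (N : label -> {RV P >-> nat}) (X : label -> {RV P >-> R})
    (d' : measure_display) (T' : measurableType d') (P' : probability T' R)
    (xi : label -> nat -> {RV P' >-> R}) :
  0 <= x -> (1 <= n)%N ->
  continuum_cascade P x N X -> branching_poisson P' xi ->
  height_cdf P N n.-1 = P [set w | (height N R w <= (n.-1%:R)%:E)%E] /\
  P [set w | (height N R w <= (n.-1%:R)%:E)%E] =
    P' [set w | (x%:E <= leftmost xi n w)%E].
Proof.
move=> _; case: n => [//|n] _ cascade branching /=; split=> //.
by rewrite (cascade_height_le cascade) (leftmost_ge branching).
Qed.
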